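(* Let $P$ be a TraP and, for any $k,l\ge0$, let $x_{k,l}\in P(k,l)$ be such that $\sigma\cdot x_{k,l}\cdot\tau=x_{k,l}$ for all $\sigma\in\mathfrak S_l$, $\tau\in\mathfrak S_k$. There exists a unique TraP morphism $\Phi:\mathbf{Gr}\to P$ sending $G_{k,l}$ to $x_{k,l}$ for all $k,l\ge0$.
   Context: $[n]=\{1,\dots,n\}$. Graphs. A graph is a tuple $G=(V(G),E(G),I(G),O(G),IO(G),L(G),s,t,\alpha,\beta)$ where $V(G)$ (vertices), $E(G)$ (internal edges), $I(G)$ (input edges), $O(G)$ (output edges), $IO(G)$ (input-output edges), $L(G)$ (loops) are finite sets, $s:E(G)\sqcup O(G)\to V(G)$, $t:E(G)\sqcup I(G)\to V(G)$, $\alpha:I(G)\sqcup IO(G)\to[i(G)]$ a bijection with $i(G)=|I(G)|+|IO(G)|$, $\beta:O(G)\sqcup IO(G)\to[o(G)]$ a bijection with $o(G)=|O(G)|+|IO(G)|$. $\mathbf{Gr}(k,l)$ is the vector space with basis the isoclasses of graphs with $i(G)=k$, $o(G)=l$. $G_{k,l}$ is the graph with one vertex $\star$, $E=IO=L=\emptyset$, $I=[k]$, $O=[l]$, $\alpha,\beta$ identities, all input edges with target $\star$ and all output edges with source $\star$. TraP structure on $\mathbf{Gr}$: $\sigma\cdot G$ replaces $\beta$ by $\sigma\circ\beta$; $G\cdot\tau$ replaces $\alpha$ by $\tau^{-1}\circ\alpha$; $G*G'$ is the disjoint union with input/output indices of $G'$ shifted by $i(G)$, resp. $o(G)$ (unit: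 empty graph). Partial traces: for $k,l\ge1$, $i\in[k]$, $j\in[l]$, with $e_i=\alpha^{-1}(i)$, $f_j=\beta^{-1}(j)$, $t_{i,j}(G)$ glues $e_i$ to $f_j$: if $e_i\in I(G)$, $f_j\in O(G)$ they become a new internal edge from $s(f_j)$ to $t(e_i)$; if $e_i\in IO(G)$, $f_j\in O(G)$, a new output edge with source $s(f_j)$ and output index $\beta(e_i)$; if $e_i\in I(G)$, $f_j\in IO(G)$, a new input edge with target $t(e_i)$ and input index $\alpha(f_j)$; if $e_i\ne f_j$ both in $IO(G)$, a new input-output edge with input index $\alpha(f_j)$, output index $\beta(e_i)$; if $e_i=f_j$, a new loop; then input indices $>i$ and output indices $>j$ are decreased by $1$. Unit $I$: the graph with a single input-output edge. TraP. A TraP is a family $P=(P(k,l))_{k,l\ge0}$ of vector spaces such that: (1) each $P(k,l)$ is a $\mathfrak S_l\times\mathfrak S_k^{op}$-module; (2) a horizontal concatenation $*:P(k,l)\otimes P(k',l')\to P(k+k',l+l')$, associative with unit $I_0\in P(0,0)$, with $(\sigma\cdot p\cdot\tau)*(\sigma'\cdot p'\cdot\tau')=(\sigma\otimes\sigma')\cdot(p*p')\cdot(\tau\otimes\tau')$ and $c_{l,l'}\cdot(p*p')=(p'*p)\cdot c_{k,k'}$ ($\alpha\otimes\beta$ is $\alpha$ on $[m]$ and $i\mapsto\beta(i-m)+m$ for $i>m$; $c_{m,n}(i)=i+n$ for $i\le m$, $i-m$ for $i>m$); (3) linear maps $t_{i,j}:P(k,l)\to P(k-1,l-1)$ for $k,l\ge1$,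 $i\in[k]$, $j\in[l]$, with: (a) for $i'\in[k-1]$, $j'\in[l-1]$: $t_{i',j'}t_{i,j}=t_{i-1,j-1}t_{i',j'}$ if $i'<i,j'<j$; $=t_{i,j-1}t_{i'+1,j'}$ if $i'\ge i,j'<j$; $=t_{i-1,j}t_{i',j'+1}$ if $i'<i,j'\ge j$; $=t_{i,j}t_{i'+1,j'+1}$ if $i'\ge i,j'\ge j$; (b) $t_{i,j}(\sigma\cdot p\cdot\tau)=\sigma_j\cdot t_{\tau(i),\sigma^{-1}(j)}(p)\cdot\tau_i$, where $\alpha_p\in\mathfrak S_{n-1}$ has word obtained from $\alpha(1)\cdots\alpha(n)$ by deleting the letter $p$ and subtracting $1$ from letters $>p$; (c) for $p\in P(k,l)$: $t_{i,j}(p*p')=t_{i,j}(p)*p'$ if $i\le k,j\le l$, and $=p*t_{i-k,j-l}(p')$ if $i>k,j>l$; (d) there is $I\in P(1,1)$ with, for $p\in P(k,l)$: $t_{1,j}(I*p)=(1,\dots,j-1)\cdot p$ ($j\ge2$), $t_{i,1}(I*p)=p\cdot(1,\dots,i-1)^{-1}$ ($i\ge2$), $t_{k+1,j}(p*I)=(j,\dots,l)^{-1}\cdot p$ ($j\le l$), $t_{i,l+1}(p*I)=p\cdot(i,\dots,k)$ ($i\le k$), cycles written $(a_1,\dots,a_r)$. A TraP morphism is a family of linear maps $P(k,l)\to Q(k,l)$ commuting with the symmetric group actions, with $*$ and with all partial trace maps.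
   Formalization: TraP morphisms are also required to preserve the units I_0 and I (otherwise, for x = 0, the zero family breaks uniqueness), and in axiom (3)(b) the right factor τ_i is corrected to τ_{τ(i)}, without which Gr is not a TraP. *)

(* Defs.v *)
From HB Require Import structures.
From mathcomp Require Import all_boot all_fingroup all_algebra.
From mathcomp Require Import boolp.
From mathcomp Require Import finmap monalg.

Set Implicit Arguments.
Unset Strict Implicit.
Unset Printing Implicit Defensive.

Import GRing.Theory.
Local Open Scope ring_scope.
Local Open Scope quotient_scope.

(** Conventions.  [[n]] is ['I_n], so indices start at 0.  Products in ['S_n]
    follow MathComp: [(s * t) x = t (s x)], so the composite "s after t" of the
    usual mathematical convention is written [t * s]. *)

(** * Permutations *)

Definition sum_map (A A' B B' : Type) (f : A -> A') (g : B -> B')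
    (x : A + B) : A' + B' :=
  match x with inl a => inl (f a) | inr b => inr (g b) end.

Lemma sum_map_bij (A A' B B' : Type) (f : A -> A') (g : B -> B') :
  bijective f -> bijective g -> bijective (sum_map f g).
Proof.
case=> f' fK f'K [g' gK g'K].
by exists (sum_map f' g') => -[x|x] /=; rewrite ?fK ?gK ?f'K ?g'K.
Qed.

Lemma perm_bij (T : finType) (s : {perm T}) : bijective s.
Proof. by exists (s^-1)%g; [exact: permK | exact: permKV]. Qed.

Lemma unsplit_bij (m n : nat) : bijective (@unsplit m n).
Proof. by exists (@split m n); [exact: unsplitK | exact: splitK]. Qed.

Lemma split_bij (m n : nat) : bijective (@split m n).
Proof. by exists (@unsplit m n); [exact: splitK | exact: unsplitK]. Qed.

Lemma tensor_perm_subproof (m n : nat) (s : 'S_m) (t : 'S_n) :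
  injective (fun x => unsplit (sum_map s t (split x))).
Proof.
apply: bij_inj; apply: (bij_comp (@unsplit_bij m n)).
by apply: (bij_comp _ (@split_bij m n)); apply: sum_map_bij; exact: perm_bij.
Qed.

Definition tensor_perm (m n : nat) (s : 'S_m) (t : 'S_n) : 'S_(m + n) :=
  perm (@tensor_perm_subproof m n s t).

Definition sum_swap (A B : Type) (x : A + B) : B + A :=
  match x with inl a => inr a | inr b => inl b end.

Lemma block_perm_subproof (m n : nat) :
  injective (fun x : 'I_(m + n) =>
    cast_ord (addnC n m) (unsplit (sum_swap (split x)))).
Proof.
move=> x y /cast_ord_inj /(bij_inj (@unsplit_bij n m)) e.
apply: (bij_inj (@split_bij m n)).
by case: (split x) (split y) e => [a|a] [b|b] //= [->].
Qed.

(** c_(m,n): the first [m] letters move up by [n], the others down by [m]. *)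
Definition block_perm (m n : nat) : 'S_(m + n) :=
  perm (@block_perm_subproof m n).

(** The cycle (a_1, ..., a_r), for a duplicate-free list of letters. *)
Definition cycle_perm (n : nat) (s : seq 'I_n) : 'S_n :=
  perm (can_inj (prev_next (undup_uniq s))).

Definition cycle_upto (n : nat) (j : 'I_n) : 'S_n :=
  cycle_perm [seq x : 'I_n <- enum 'I_n | (x <= j)%N].

Definition cycle_from (n : nat) (j : 'I_n) : 'S_n :=
  cycle_perm [seq x : 'I_n <- enum 'I_n | (j <= x)%N].

Lemma shrink_subproof (n : nat) (i x : 'I_n.+1) :
  x != i -> (unbump i x < n)%N.
Proof.
rewrite eq_sym => ne; have [y -> _] := unlift_some ne.
by rewrite /= bumpK.
Qed.

(** Decrease the letters larger than [i] by one, once [i] has been removed. *)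
Definition shrink (n : nat) (i x : 'I_n.+1) (ne : x != i) : 'I_n :=
  Ordinal (shrink_subproof ne).

Lemma lift_shrink (n : nat) (i x : 'I_n.+1) (ne : x != i) :
  lift i (shrink ne) = x.
Proof.
by apply: val_inj; rewrite /= unbumpK // inE; move: ne; rewrite -val_eqE.
Qed.

Lemma del_perm_neq (n : nat) (s : 'S_n.+1) (p : 'I_n.+1) (x : 'I_n) :
  s (lift ((s^-1)%g p) x) != p.
Proof.
by apply/eqP => e; move: (neq_lift ((s^-1)%g p) x); rewrite -{1}e permK eqxx.
Qed.

Lemma del_perm_subproof (n : nat) (s : 'S_n.+1) (p : 'I_n.+1) :
  injective (fun x => shrink (del_perm_neq s p x)).
Proof.
move=> x y /(congr1 (lift p)); rewrite !lift_shrink => /perm_inj.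
exact: lift_inj.
Qed.

(** s_p: delete the letter [p] from the word of [s] and renumber.  The letter
    [p] sits at position [s^-1 p]. *)
Definition del_perm (n : nat) (s : 'S_n.+1) (p : 'I_n.+1) : 'S_n :=
  perm (@del_perm_subproof n s p).

(** * TraPs *)

Section Traps.
Variable K : fieldType.

Record trap_ops := TrapOps {
  trap_car :> nat -> nat -> lmodType K;
  actl : forall k l : nat, 'S_l -> trap_car k l -> trap_car k l;
  actr : forall k l : nat, trap_car k l -> 'S_k -> trap_car k l;
  hcat : forall k l k' l' : nat,
    trap_car k l -> trap_car k' l' -> trap_car (k + k') (l + l');
  hunit : trap_car 0 0;
  ptr : forall k l : nat,
    'I_k.+1 -> 'I_l.+1 -> trap_car k.+1 l.+1 -> trap_car k l;
  wire : trap_car 1 1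
}.

Definition tcast (P : trap_ops) (k l k' l' : nat) (ek : k = k') (el : l = l')
    (p : P k l) : P k' l' :=
  ecast n (P n l') ek (ecast n (P k n) el p).

Record is_trap (P : trap_ops) : Prop := IsTrap {
  actl_linear : forall (k l : nat) (s : 'S_l), linear (@actl P k l s);
  actr_linear : forall (k l : nat) (t : 'S_k),
    linear (fun p : P k l => actr p t);
  actl1 : forall (k l : nat) (p : P k l), actl 1%g p = p;
  actlM : forall (k l : nat) (s s' : 'S_l) (p : P k l),
    actl (s' * s)%g p = actl s (actl s' p);
  actr1 : forall (k l : nat) (p : P k l), actr p 1%g = p;
  actrM : forall (k l : nat) (t t' : 'S_k) (p : P k l),
    actr p (t' * t)%g = actr (actr p t) t';
  actlr : forall (k l : nat) (s : 'S_l) (t : 'S_k) (p : P k l),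
    actr (actl s p) t = actl s (actr p t);

  hcat_linearl : forall (k l k' l' : nat) (p' : P k' l'),
    linear (fun p : P k l => hcat p p');
  hcat_linearr : forall (k l k' l' : nat) (p : P k l),
    linear (fun p' : P k' l' => hcat p p');
  hcatA : forall (k l k' l' k'' l'' : nat)
      (p : P k l) (p' : P k' l') (p'' : P k'' l''),
    tcast (esym (addnA k k' k'')) (esym (addnA l l' l''))
      (hcat (hcat p p') p'') = hcat p (hcat p' p'');
  hcat0p : forall (k l : nat) (p : P k l), hcat (hunit P) p = p;
  hcatp0 : forall (k l : nat) (p : P k l),
    tcast (addn0 k) (addn0 l) (hcat p (hunit P)) = p;
  hcat_act : forall (k l k' l' : nat) (p : P k l) (p' : P k' l')
      (s : 'S_l) (t : 'S_k) (s' : 'S_l') (t' : 'S_k'),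
    hcat (actr (actl s p) t) (actr (actl s' p') t')
    = actr (actl (tensor_perm s s') (hcat p p')) (tensor_perm t t');
  hcatC : forall (k l k' l' : nat) (p : P k l) (p' : P k' l'),
    actl (block_perm l l') (hcat p p')
    = actr (tcast (addnC k' k) (addnC l' l) (hcat p' p)) (block_perm k k');

  ptr_linear : forall (k l : nat) (i : 'I_k.+1) (j : 'I_l.+1),
    linear (@ptr P k l i j);
  ptr_lt_lt : forall (k l : nat) (i : 'I_k.+2) (j : 'I_l.+2)
      (i' : 'I_k.+1) (j' : 'I_l.+1) (p : P k.+2 l.+2),
    (i' < i)%N -> (j' < j)%N ->
    ptr i' j' (ptr i j p)
    = ptr (inord i.-1) (inord j.-1) (ptr (inord i') (inord j') p);
  ptr_ge_lt : forall (k l : nat) (i : 'I_k.+2) (j : 'I_l.+2)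
      (i' : 'I_k.+1) (j' : 'I_l.+1) (p : P k.+2 l.+2),
    (i <= i')%N -> (j' < j)%N ->
    ptr i' j' (ptr i j p)
    = ptr (inord i) (inord j.-1) (ptr (inord i'.+1) (inord j') p);
  ptr_lt_ge : forall (k l : nat) (i : 'I_k.+2) (j : 'I_l.+2)
      (i' : 'I_k.+1) (j' : 'I_l.+1) (p : P k.+2 l.+2),
    (i' < i)%N -> (j <= j')%N ->
    ptr i' j' (ptr i j p)
    = ptr (inord i.-1) (inord j) (ptr (inord i') (inord j'.+1) p);
  ptr_ge_ge : forall (k l : nat) (i : 'I_k.+2) (j : 'I_l.+2)
      (i' : 'I_k.+1) (j' : 'I_l.+1) (p : P k.+2 l.+2),
    (i <= i')%N -> (j <= j')%N ->
    ptr i' j' (ptr i j p)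
    = ptr (inord i) (inord j) (ptr (inord i'.+1) (inord j'.+1) p);
  (** On the input side the letter to delete from the word of [t] is [t i],
      the input of [p] that is being traced. *)
  ptr_act : forall (k l : nat) (i : 'I_k.+1) (j : 'I_l.+1) (p : P k.+1 l.+1)
      (s : 'S_l.+1) (t : 'S_k.+1),
    ptr i j (actr (actl s p) t)
    = actr (actl (del_perm s j) (ptr (t i) ((s^-1)%g j) p)) (del_perm t (t i));
  ptr_hcatl : forall (k l k' l' : nat) (i : 'I_k.+1) (j : 'I_l.+1)
      (p : P k.+1 l.+1) (p' : P k' l'),
    @ptr P (k + k') (l + l') (lshift k' i) (lshift l' j) (hcat p p')
    = hcat (ptr i j p) p';
  ptr_hcatr : forall (k l k' l' : nat) (i : 'I_k'.+1) (j : 'I_l'.+1)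
      (p : P k l) (p' : P k'.+1 l'.+1),
    ptr (cast_ord (addnS k k') (rshift k i))
        (cast_ord (addnS l l') (rshift l j))
        (tcast (addnS k k') (addnS l l') (hcat p p'))
    = hcat p (ptr i j p');
  ptr_wirel_out : forall (k l : nat) (j : 'I_l) (p : P k l),
    @ptr P k l ord0 (lift ord0 j) (hcat (wire P) p) = actl (cycle_upto j) p;
  ptr_wirel_in : forall (k l : nat) (i : 'I_k) (p : P k l),
    @ptr P k l (lift ord0 i) ord0 (hcat (wire P) p)
    = actr p (cycle_upto i)^-1%g;
  ptr_wirer_out : forall (k l : nat) (j : 'I_l) (p : P k l),
    ptr ord_max (widen_ord (leqnSn l) j)
        (tcast (addn1 k) (addn1 l) (hcat p (wire P)))
    = actl (cycle_from j)^-1%g p;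
  ptr_wirer_in : forall (k l : nat) (i : 'I_k) (p : P k l),
    ptr (widen_ord (leqnSn k) i) ord_max
        (tcast (addn1 k) (addn1 l) (hcat p (wire P)))
    = actr p (cycle_from i)
}.

Record trap := Trap {
  trap_struct :> trap_ops;
  trap_axioms : is_trap trap_struct
}.

(** TraPs being unital structures, their morphisms preserve the unit of the
    concatenation and the unit of the partial traces. *)
Record is_trap_morphism (P Q : trap_ops) (f : forall k l : nat, P k l -> Q k l) :
    Prop := IsTrapMorphism {
  morph_linear : forall k l : nat, linear (f k l);
  morph_actl : forall (k l : nat) (s : 'S_l) (p : P k l),
    f k l (actl s p) = actl s (f k l p);
  morph_actr : forall (k l : nat) (t : 'S_k) (p : P k l),
    f k l (actr p t) = actr (f k l p) t;
  morph_hcat : forall (k l k' l' : nat) (p : P k l) (p' : P k' l'),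
    f _ _ (hcat p p') = hcat (f k l p) (f k' l' p');
  morph_ptr : forall (k l : nat) (i : 'I_k.+1) (j : 'I_l.+1)
      (p : P k.+1 l.+1),
    f k l (ptr i j p) = ptr i j (f _ _ p);
  morph_hunit : f 0%N 0%N (hunit P) = hunit Q;
  morph_wire : f 1%N 1%N (wire P) = wire Q
}.

End Traps.

(** * Graphs *)

(** The graphs with [i(G) = k] and [o(G) = l]; these two equalities follow from
    the bijectivity of [galpha] and [gbeta]. *)
Record graph (k l : nat) := Graph {
  gV : finType;
  gE : finType;
  gI : finType;
  gO : finType;
  gIO : finType;
  gL : finType;
  gsrc : gE + gO -> gV;
  gtgt : gE + gI -> gV;
  galpha : gI + gIO -> 'I_k;
  gbeta : gO + gIO -> 'I_l;
  galpha_bij : bijective galpha;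
  gbeta_bij : bijective gbeta
}.

Record graph_iso_on (k l : nat) (G H : graph k l)
    (fV : gV G -> gV H) (fE : gE G -> gE H) (fI : gI G -> gI H)
    (fO : gO G -> gO H) (fIO : gIO G -> gIO H) (fL : gL G -> gL H) : Prop :=
  GraphIsoOn {
  gi_V : bijective fV;
  gi_E : bijective fE;
  gi_I : bijective fI;
  gi_O : bijective fO;
  gi_IO : bijective fIO;
  gi_L : bijective fL;
  gi_src : forall x, gsrc (sum_map fE fO x) = fV (gsrc x);
  gi_tgt : forall x, gtgt (sum_map fE fI x) = fV (gtgt x);
  gi_alpha : forall x, galpha (sum_map fI fIO x) = galpha x;
  gi_beta : forall x, gbeta (sum_map fO fIO x) = gbeta x
}.

Definition graph_iso (k l : nat) (G H : graph k l) : Prop :=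
  exists fV fE fI fO fIO fL, @graph_iso_on k l G H fV fE fI fO fIO fL.

Lemma graph_iso_refl (k l : nat) (G : graph k l) : graph_iso G G.
Proof.
exists id, id, id, id, id, id; split; try by exists id.
all: by case.
Qed.

Lemma graph_iso_sym (k l : nat) (G H : graph k l) :
  graph_iso G H -> graph_iso H G.
Proof.
case=> fV [fE [fI [fO [fIO [fL]]]]].
case=> -[gV' VK KV] [gE' EK KE] [gI' IK KI] [gO' OK KO] [gIO' IOK KIO].
case=> gL' LK KL hs ht ha hb.
exists gV', gE', gI', gO', gIO', gL'; split; try by [exists fV | exists fE |
  exists fI | exists fO | exists fIO | exists fL].
- by move=> x; apply: (can_inj VK); rewrite KV -hs; case: x => x /=; rewrite ?KE ?KO.
- by move=> x; apply: (can_inj VK); rewrite KV -ht; case: x => x /=; rewrite ?KE ?KI.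
- by move=> x; rewrite -ha; case: x => x /=; rewrite ?KI ?KIO.
- by move=> x; rewrite -hb; case: x => x /=; rewrite ?KO ?KIO.
Qed.

Lemma graph_iso_trans (k l : nat) (G H J : graph k l) :
  graph_iso G H -> graph_iso H J -> graph_iso G J.
Proof.
case=> fV [fE [fI [fO [fIO [fL]]]]] [? ? ? ? ? ? hs ht ha hb].
case=> gV' [gE' [gI' [gO' [gIO' [gL']]]]] [? ? ? ? ? ? hs' ht' ha' hb'].
exists (gV' \o fV), (gE' \o fE), (gI' \o fI), (gO' \o fO), (gIO' \o fIO),
  (gL' \o fL).
split; try exact: bij_comp.
- by move=> x; rewrite /= -hs -hs'; case: x.
- by move=> x; rewrite /= -ht -ht'; case: x.
- by move=> x; rewrite -ha -ha'; case: x.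
- by move=> x; rewrite -hb -hb'; case: x.
Qed.

(** ** Isomorphism classes *)

(** Finite types form too large a type to be quotiented: isoclasses are
    represented by the graphs all of whose carriers are of the form ['I_n]. *)
Record sgraph (k l : nat) := SGraph {
  sV : nat;
  sE : nat;
  sI : nat;
  sO : nat;
  sIO : nat;
  sL : nat;
  ssrc : 'I_sE + 'I_sO -> 'I_sV;
  stgt : 'I_sE + 'I_sI -> 'I_sV;
  salpha : 'I_sI + 'I_sIO -> 'I_k;
  sbeta : 'I_sO + 'I_sIO -> 'I_l;
  salpha_bij : bijective salpha;
  sbeta_bij : bijective sbeta
}.

HB.instance Definition _ (k l : nat) := gen_eqMixin (sgraph k l).
HB.instance Definition _ (k l : nat) := gen_choiceMixin (sgraph k l).

Definition of_sgraph (k l : nat) (G : sgraph k l) : graph k l :=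
  @Graph k l 'I_(sV G) 'I_(sE G) 'I_(sI G) 'I_(sO G) 'I_(sIO G) 'I_(sL G)
    (@ssrc k l G) (@stgt k l G) (@salpha k l G) (@sbeta k l G)
    (salpha_bij G) (sbeta_bij G).

Section ToSgraph.
Variables (k l : nat) (G : graph k l).

Definition to_sgraph : sgraph k l :=
  @SGraph k l #|gV G| #|gE G| #|gI G| #|gO G| #|gIO G| #|gL G|
    (fun x => enum_rank (gsrc (sum_map enum_val enum_val x)))
    (fun x => enum_rank (gtgt (sum_map enum_val enum_val x)))
    (fun x => galpha (sum_map enum_val enum_val x))
    (fun x => gbeta (sum_map enum_val enum_val x))
    (bij_comp (galpha_bij G)
       (sum_map_bij (enum_val_bij (gI G)) (enum_val_bij (gIO G))))
    (bij_comp (gbeta_bij G)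
       (sum_map_bij (enum_val_bij (gO G)) (enum_val_bij (gIO G)))).

Lemma to_sgraph_iso : graph_iso (of_sgraph to_sgraph) G.
Proof.
do 6![exists enum_val]; split; try exact: enum_val_bij.
all: by move=> x; rewrite /= ?enum_rankK.
Qed.

End ToSgraph.

Definition sgraph_iso (k l : nat) (G H : sgraph k l) : bool :=
  `[< graph_iso (of_sgraph G) (of_sgraph H) >].

Lemma sgraph_iso_equiv (k l : nat) :
  equiv_class_of (@sgraph_iso k l).
Proof.
split.
- by move=> G; apply/asboolP; exact: graph_iso_refl.
- by move=> G H; apply/asboolP/asboolP; exact: graph_iso_sym.
- move=> H G J /asboolP GH /asboolP HJ; apply/asboolP.
  exact: graph_iso_trans GH HJ.
Qed.

Canonical sgraph_iso_rel (k l : nat) := EquivRelPack (@sgraph_iso_equiv k l).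

Definition isoclass (k l : nat) := {eq_quot @sgraph_iso k l}.
HB.instance Definition _ (k l : nat) := Choice.on (isoclass k l).

Definition class_of_graph (k l : nat) (G : graph k l) : isoclass k l :=
  \pi_(isoclass k l) (to_sgraph G).

Definition graph_of_class (k l : nat) (c : isoclass k l) : graph k l :=
  of_sgraph (generic_quotient.repr c).

Lemma class_of_graphP (k l : nat) (G H : graph k l) :
  class_of_graph G = class_of_graph H <-> graph_iso G H.
Proof.
split.
- move/eqquotP/asboolP => h.
  apply: graph_iso_trans (to_sgraph_iso H).
  exact: graph_iso_trans (graph_iso_sym (to_sgraph_iso G)) h.
- move=> h; apply/eqquotP/asboolP.
  apply: graph_iso_trans (to_sgraph_iso G) _.
  exact: graph_iso_trans h (graph_iso_sym (to_sgraph_iso H)).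
Qed.

Lemma graph_of_classK (k l : nat) : cancel (@graph_of_class k l) (@class_of_graph k l).
Proof.
move=> c; rewrite /class_of_graph -[RHS]reprK; apply/eqquotP/asboolP.
exact: to_sgraph_iso.
Qed.

(** ** Operations on graphs *)

Section GraphAct.
Variables (k l : nat) (G : graph k l).

Definition graph_actl (s : 'S_l) : graph k l :=
  @Graph k l (gV G) (gE G) (gI G) (gO G) (gIO G) (gL G)
    (@gsrc k l G) (@gtgt k l G) (@galpha k l G) (s \o @gbeta k l G)
    (galpha_bij G) (bij_comp (perm_bij s) (gbeta_bij G)).

Definition graph_actr (t : 'S_k) : graph k l :=
  @Graph k l (gV G) (gE G) (gI G) (gO G) (gIO G) (gL G)
    (@gsrc k l G) (@gtgt k l G) ((t^-1)%g \o @galpha k l G) (@gbeta k l G)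
    (bij_comp (perm_bij (t^-1)%g) (galpha_bij G)) (gbeta_bij G).

End GraphAct.

Definition sum_shuffle (A B C D : Type) (x : (A + B) + (C + D)) :
    (A + C) + (B + D) :=
  match x with
  | inl (inl a) => inl (inl a)
  | inl (inr b) => inr (inl b)
  | inr (inl c) => inl (inr c)
  | inr (inr d) => inr (inr d)
  end.

Lemma sum_shuffle_bij (A B C D : Type) : bijective (@sum_shuffle A B C D).
Proof. by exists (@sum_shuffle A C B D) => -[[]|[]]. Qed.

Section GraphCat.
Variables (k l k' l' : nat) (G : graph k l) (H : graph k' l').

Definition graph_cat : graph (k + k') (l + l') :=
  @Graph (k + k') (l + l') (gV G + gV H)%type (gE G + gE H)%type
    (gI G + gI H)%type (gO G + gO H)%type (gIO G + gIO H)%type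
    (gL G + gL H)%type
    (sum_map (@gsrc _ _ G) (@gsrc _ _ H) \o @sum_shuffle _ _ _ _)
    (sum_map (@gtgt _ _ G) (@gtgt _ _ H) \o @sum_shuffle _ _ _ _)
    (@unsplit k k' \o
       (sum_map (@galpha _ _ G) (@galpha _ _ H) \o @sum_shuffle _ _ _ _))
    (@unsplit l l' \o
       (sum_map (@gbeta _ _ G) (@gbeta _ _ H) \o @sum_shuffle _ _ _ _))
    (bij_comp (@unsplit_bij k k')
       (bij_comp (sum_map_bij (galpha_bij G) (galpha_bij H))
                 (@sum_shuffle_bij _ _ _ _)))
    (bij_comp (@unsplit_bij l l')
       (bij_comp (sum_map_bij (gbeta_bij G) (gbeta_bij H))
                 (@sum_shuffle_bij _ _ _ _))).

End GraphCat.

Lemma void_sum_bij (A : Type) :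
  bijective (fun x : A + void => match x with inl a => a | inr v => of_void A v end).
Proof. by exists inl => // -[a|[]]. Qed.

Lemma void_ord0_bij :
  bijective (fun x : void + void =>
    match x with inl v => of_void 'I_0 v | inr v => of_void 'I_0 v end).
Proof.
have f0 (i : 'I_0) : False by case: i.
by exists (fun i => match f0 i return (void + void)%type with end) => [[[]|[]]|[]].
Qed.

Lemma unit_ord1_bij :
  bijective (fun x : void + unit =>
    match x with inl v => of_void 'I_1 v | inr _ => ord0 end).
Proof. by exists (fun=> inr tt) => [[[]|[]]|i] //; rewrite (ord1 i). Qed.

Definition empty_graph : graph 0 0 :=
  @Graph 0 0 void void void void void void
    (fun x => match x with inl v => v | inr v => v end)
    (fun x => match x with inl v => v | inr v => v end)
    _ _ void_ord0_bij void_ord0_bij.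

Definition wire_graph : graph 1 1 :=
  @Graph 1 1 void void void void unit void
    (fun x => match x with inl v => v | inr v => v end)
    (fun x => match x with inl v => v | inr v => v end)
    _ _ unit_ord1_bij unit_ord1_bij.

(** G_(k,l) *)
Definition corolla (k l : nat) : graph k l :=
  @Graph k l unit void 'I_k 'I_l void void (fun=> tt) (fun=> tt)
    _ _ (void_sum_bij 'I_k) (void_sum_bij 'I_l).

(** ** Gluing an input to an output *)

Lemma fin_bij (A B : finType) (f : A -> B) :
  injective f -> (forall y, exists x, f x = y) -> bijective f.
Proof.
move=> finj fsur; apply: inj_card_bij => //.
rewrite -(card_codom finj); apply/subset_leq_card/fintype.subsetP => y _.
by have [x <-] := fsur y; exact: codom_f.
Qed.

Lemma bij_preim_subproof (A B : finType) (f : A -> B) (y : B) :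
  bijective f -> y \in codom f.
Proof. by case=> g _ gK; rewrite -(gK y) codom_f. Qed.

Definition bij_preim (A B : finType) (f : A -> B) (fb : bijective f) (y : B) : A :=
  iinv (bij_preim_subproof y fb).

Lemma bij_preimK (A B : finType) (f : A -> B) (fb : bijective f) (y : B) :
  f (bij_preim fb y) = y.
Proof. exact: f_iinv. Qed.

(** [iota] identifies [A'] with [A] minus [a]; the indices larger than that of
    [a] are decreased by one. *)
Section Reindex.
Variables (n : nat) (A A' : finType) (f : A -> 'I_n.+1) (fb : bijective f).
Variables (a : A) (iota : A' -> A).
Hypothesis iota_neq : forall x, iota x != a.

Lemma reindex_neq (x : A') : f (iota x) != f a.
Proof. by rewrite (inj_eq (bij_inj fb)). Qed.

Definition reindex (x : A') : 'I_n := shrink (reindex_neq x).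

Hypothesis iota_inj : injective iota.
Hypothesis iota_onto : forall y, y != a -> exists x, iota x = y.

Lemma reindex_bij : bijective reindex.
Proof.
apply: fin_bij => [x y /(congr1 (lift (f a)))|i].
  by rewrite !lift_shrink => /(bij_inj fb) /iota_inj.
have [g fK gK] := fb.
have /iota_onto [x ex] : g (lift (f a) i) != a.
  apply/eqP => /(congr1 f); rewrite gK => e.
    by move: (neq_lift (f a) i); rewrite e eqxx.
exists x; apply: (@lift_inj _ (f a)).
by rewrite lift_shrink ex gK.
Qed.

End Reindex.

(** Inclusions of the input (or output) edges of a glued graph in those of the
    original one, for a set [X] of inputs (outputs) and a set [Y] of
    input-output edges.
    [incl_dropl a]: the edge [a] of [X] disappears.
    [incl_dropr b]: the edge [b] of [Y] disappears.
    [incl_takel a b]: [b] disappears from [Y], and [a] in [X] takes over its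
    index, so that it is the index of [a] which is lost.
    [incl_taker c b]: the same with [c] in [Y] in the place of [a]; if [c = b],
    then [b] just disappears. *)
Section Inclusions.
Variables X Y : finType.

Definition incl_dropl (a : X) (x : {x : X | x != a} + Y) : X + Y :=
  match x with inl x => inl (val x) | inr y => inr y end.

Definition incl_dropr (b : Y) (x : X + {y : Y | y != b}) : X + Y :=
  match x with inl x => inl x | inr y => inr (val y) end.

Definition incl_takel (a : X) (b : Y) (x : X + {y : Y | y != b}) : X + Y :=
  match x with
  | inl x => if x == a then inr b else inl x
  | inr y => inr (val y)
  end.

Definition incl_taker (c b : Y) (x : X + {y : Y | y != b}) : X + Y :=
  match x with
  | inl x => inl x
  | inr y => if val y == c then inr b else inr (val y)
  end.

Lemma incl_dropl_neq a x : @incl_dropl a x != inl a.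
Proof. by case: x => [[x ne]|y] //=; apply: contraNneq ne => -[->]. Qed.

Lemma incl_dropl_inj a : injective (@incl_dropl a).
Proof. by case=> [x|x] [y|y] //= [] => [/val_inj->|->]. Qed.

Lemma incl_dropl_onto a y : y != inl a -> exists x, @incl_dropl a x = y.
Proof.
case: y => [y|y] ne; last by exists (inr y).
have ne' : y != a by apply: contraNneq ne => ->.
by exists (inl (Sub y ne')).
Qed.

Lemma incl_dropr_neq b x : @incl_dropr b x != inr b.
Proof. by case: x => [x|[y ne]] //=; apply: contraNneq ne => -[->]. Qed.

Lemma incl_dropr_inj b : injective (@incl_dropr b).
Proof. by case=> [x|x] [y|y] //= [] => [->|/val_inj->]. Qed.

Lemma incl_dropr_onto b y : y != inr b -> exists x, @incl_dropr b x = y.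
Proof.
case: y => [y|y] ne; first by exists (inl y).
have ne' : y != b by apply: contraNneq ne => ->.
by exists (inr (Sub y ne')).
Qed.

Lemma incl_takel_neq a b x : @incl_takel a b x != inl a.
Proof.
case: x => [x|y] //=; case: (eqVneq x a) => [_ //|ne].
by apply: contraNneq ne => -[->].
Qed.

Lemma incl_takel_inj a b : injective (@incl_takel a b).
Proof.
case=> [x|[x nx]] [y|[y ny]] //=.
- by case: (eqVneq x a) => [->|_]; case: (eqVneq y a) => [->|_] //= [->].
- by case: (eqVneq x a) => // _ [e]; exfalso; move: ny; rewrite -e eqxx.
- by case: (eqVneq y a) => // _ [e]; exfalso; move: nx; rewrite e eqxx.
- by case=> e; congr inr; apply: val_inj.
Qed.

Lemma incl_takel_onto a b y : y != inl a -> exists x, @incl_takel a b x = y.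
Proof.
case: y => [y|y] ne.
  have ne' : y != a by apply: contraNneq ne => ->.
  by exists (inl y); rewrite /= (negPf ne').
have [->|ne'] := eqVneq y b; first by exists (inl a); rewrite /= eqxx.
by exists (inr (Sub y ne')).
Qed.

Lemma incl_taker_neq c b x : @incl_taker c b x != inr c.
Proof.
case: x => [x|[y ny]] //=; case: (eqVneq y c) => [<-|ne].
  by apply: contraNneq ny => -[->].
by apply: contraNneq ne => -[->].
Qed.

Lemma incl_taker_inj c b : injective (@incl_taker c b).
Proof.
case=> [x|[x nx]] [y|[y ny]] //=; try by [case=> -> | case: ifP].
case: (eqVneq x c) => [xc|_]; case: (eqVneq y c) => [yc|_] //=.
- by move=> _; congr inr; apply: val_inj; rewrite /= xc yc.
- by case=> e; exfalso; move: ny; rewrite -e eqxx.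
- by case=> e; exfalso; move: nx; rewrite e eqxx.
- by case=> e; congr inr; apply: val_inj.
Qed.

Lemma incl_taker_onto c b y : y != inr c -> exists x, @incl_taker c b x = y.
Proof.
case: y => [y|y] ne; first by exists (inl y).
have nyc : y != c by apply: contraNneq ne => ->.
have [eyb|ne'] := eqVneq y b.
  rewrite eyb in nyc *; rewrite eq_sym in nyc.
  by exists (inr (Sub c nyc)); rewrite /= eqxx.
by exists (inr (Sub y ne')); rewrite /= (negPf nyc).
Qed.

End Inclusions.

Section Glue.
Variables (k l : nat) (G : graph k.+1 l.+1).

Local Notation alpha := (@galpha _ _ G).
Local Notation beta := (@gbeta _ _ G).

(** A new internal edge [None] from the source of [f] to the target of [e]. *)
Definition glue_I_O (e : gI G) (f : gO G) : graph k l :=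
  @Graph k l (gV G) (option (gE G)) {x : gI G | x != e} {x : gO G | x != f}
    (gIO G) (gL G)
    (fun x => match x with
              | inl (Some y) => gsrc (inl y)
              | inl None => gsrc (inr f)
              | inr y => gsrc (inr (val y))
              end)
    (fun x => match x with
              | inl (Some y) => gtgt (inl y)
              | inl None => gtgt (inr e)
              | inr y => gtgt (inr (val y))
              end)
    _ _
    (reindex_bij (galpha_bij G) (@incl_dropl_neq _ (gIO G) e)
       (@incl_dropl_inj _ _ e) (@incl_dropl_onto _ _ e))
    (reindex_bij (gbeta_bij G) (@incl_dropl_neq _ (gIO G) f)
       (@incl_dropl_inj _ _ f) (@incl_dropl_onto _ _ f)).

(** The new output edge is [f], with output index that of [e]. *)
Definition glue_IO_O (e : gIO G) (f : gO G) : graph k l :=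
  @Graph k l (gV G) (gE G) (gI G) (gO G) {x : gIO G | x != e} (gL G)
    (@gsrc _ _ G) (@gtgt _ _ G)
    _ _
    (reindex_bij (galpha_bij G) (@incl_dropr_neq (gI G) _ e)
       (@incl_dropr_inj _ _ e) (@incl_dropr_onto _ _ e))
    (reindex_bij (gbeta_bij G) (@incl_takel_neq _ _ f e)
       (@incl_takel_inj _ _ f e) (@incl_takel_onto _ _ f e)).

(** The new input edge is [e], with input index that of [f]. *)
Definition glue_I_IO (e : gI G) (f : gIO G) : graph k l :=
  @Graph k l (gV G) (gE G) (gI G) (gO G) {x : gIO G | x != f} (gL G)
    (@gsrc _ _ G) (@gtgt _ _ G)
    _ _
    (reindex_bij (galpha_bij G) (@incl_takel_neq _ _ e f)
       (@incl_takel_inj _ _ e f) (@incl_takel_onto _ _ e f))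
    (reindex_bij (gbeta_bij G) (@incl_dropr_neq (gO G) _ f)
       (@incl_dropr_inj _ _ f) (@incl_dropr_onto _ _ f)).

(** If [e != f], the new input-output edge is [f], with its own input index and
    the output index of [e]; if [e = f], this edge disappears and there is a new
    loop. *)
Definition glue_IO_IO (e f : gIO G) : graph k l :=
  @Graph k l (gV G) (gE G) (gI G) (gO G) {x : gIO G | x != e}
    (if e == f then option (gL G) : finType else gL G)
    (@gsrc _ _ G) (@gtgt _ _ G)
    _ _
    (reindex_bij (galpha_bij G) (@incl_dropr_neq (gI G) _ e)
       (@incl_dropr_inj _ _ e) (@incl_dropr_onto _ _ e))
    (reindex_bij (gbeta_bij G) (@incl_taker_neq (gO G) _ f e)
       (@incl_taker_inj _ _ f e) (@incl_taker_onto _ _ f e)).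

Definition glue (e : gI G + gIO G) (f : gO G + gIO G) : graph k l :=
  match e, f with
  | inl e, inl f => glue_I_O e f
  | inr e, inl f => glue_IO_O e f
  | inl e, inr f => glue_I_IO e f
  | inr e, inr f => glue_IO_IO e f
  end.

Definition graph_ptr (i : 'I_k.+1) (j : 'I_l.+1) : graph k l :=
  glue (bij_preim (galpha_bij G) i) (bij_preim (gbeta_bij G) j).

End Glue.

(** ** Invariance under isomorphism *)

Lemma graph_actl_iso (k l : nat) (G H : graph k l) (s : 'S_l) :
  graph_iso G H -> graph_iso (graph_actl G s) (graph_actl H s).
Proof.
case=> fV [fE [fI [fO [fIO [fL]]]]] [? ? ? ? ? ? hs ht ha hb].
exists fV, fE, fI, fO, fIO, fL; split => //.
by move=> x; rewrite /= hb.
Qed.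

Lemma graph_actr_iso (k l : nat) (G H : graph k l) (t : 'S_k) :
  graph_iso G H -> graph_iso (graph_actr G t) (graph_actr H t).
Proof.
case=> fV [fE [fI [fO [fIO [fL]]]]] [? ? ? ? ? ? hs ht ha hb].
exists fV, fE, fI, fO, fIO, fL; split => //.
by move=> x; rewrite /= ha.
Qed.

Lemma graph_cat_iso (k l k' l' : nat) (G H : graph k l) (G' H' : graph k' l') :
  graph_iso G H -> graph_iso G' H' ->
  graph_iso (graph_cat G G') (graph_cat H H').
Proof.
case=> fV [fE [fI [fO [fIO [fL]]]]] [? ? ? ? ? ? hs ht ha hb].
case=> gV' [gE' [gI' [gO' [gIO' [gL']]]]] [? ? ? ? ? ? hs' ht' ha' hb'].
exists (sum_map fV gV'), (sum_map fE gE'), (sum_map fI gI'),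
  (sum_map fO gO'), (sum_map fIO gIO'), (sum_map fL gL').
split; try exact: sum_map_bij.
- move=> [[x|x]|[x|x]] /=.
  + by rewrite -(hs (inl x)). + by rewrite -(hs' (inl x)).
  + by rewrite -(hs (inr x)). + by rewrite -(hs' (inr x)).
- move=> [[x|x]|[x|x]] /=.
  + by rewrite -(ht (inl x)). + by rewrite -(ht' (inl x)).
  + by rewrite -(ht (inr x)). + by rewrite -(ht' (inr x)).
- move=> [[x|x]|[x|x]] /=.
  + by rewrite -(ha (inl x)). + by rewrite -(ha' (inl x)).
  + by rewrite -(ha (inr x)). + by rewrite -(ha' (inr x)).
- move=> [[x|x]|[x|x]] /=.
  + by rewrite -(hb (inl x)). + by rewrite -(hb' (inl x)).
  + by rewrite -(hb (inr x)). + by rewrite -(hb' (inr x)).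
Qed.

Lemma sub_map_subproof (A B : finType) (f : A -> B) (a : A) :
  injective f -> forall x : {x : A | x != a}, f (val x) != f a.
Proof. by move=> fi x; rewrite (inj_eq fi) (valP x). Qed.

Definition sub_map (A B : finType) (f : A -> B) (fi : injective f) (a : A)
    (x : {x : A | x != a}) : {y : B | y != f a} :=
  Sub (f (val x)) (sub_map_subproof fi x).

Lemma sub_map_bij (A B : finType) (f : A -> B) (fi : injective f) (a : A) :
  bijective f -> bijective (@sub_map A B f fi a).
Proof.
case=> g fK gK; apply: fin_bij.
  by move=> x y /(congr1 val) /= /fi /val_inj.
case=> y ny.
have ng : g y != a by apply: contraNneq ny => <-; rewrite gK.
by exists (Sub (g y) ng); apply: val_inj; rewrite /= gK.
Qed.

Lemma reindex_eq (n : nat) (A A' B B' : finType)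
    (f : A -> 'I_n.+1) (fb : bijective f) (a : A) (iota : A' -> A)
    (iota_neq : forall x, iota x != a)
    (g : B -> 'I_n.+1) (gb : bijective g) (b : B) (eta : B' -> B)
    (eta_neq : forall x, eta x != b) (x : A') (y : B') :
  f a = g b -> f (iota x) = g (eta y) ->
  reindex fb iota_neq x = reindex gb eta_neq y.
Proof. by move=> e1 e2; apply: val_inj; rewrite /= e1 e2. Qed.

Lemma option_map_bij (A B : Type) (f : A -> B) :
  bijective f -> bijective (option_map f).
Proof. by case=> g fK gK; exists (option_map g) => -[x|] //=; rewrite ?fK ?gK. Qed.

Lemma glue_iso (k l : nat) (G H : graph k.+1 l.+1)
    fV fE fI fO fIO fL (e : gI G + gIO G) (f : gO G + gIO G) :
  @graph_iso_on _ _ G H fV fE fI fO fIO fL ->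
  graph_iso (glue e f) (glue (sum_map fI fIO e) (sum_map fO fIO f)).
Proof.
case=> bV bE bI bO bIO bL hs ht ha hb.
have iI := bij_inj bI; have iO := bij_inj bO; have iIO := bij_inj bIO.
case: e f => [e|e] [f|f] /=.
- exists fV, (option_map fE), (@sub_map _ _ _ iI e), (@sub_map _ _ _ iO f),
    fIO, fL; split => //; try exact: sub_map_bij; try exact: option_map_bij.
  + case=> [[x|]|x] /=; [exact: (hs (inl x)) | exact: (hs (inr f)) |].
    exact: (hs (inr (val x))).
  + case=> [[x|]|x] /=; [exact: (ht (inl x)) | exact: (ht (inr e)) |].
    exact: (ht (inr (val x))).
  + case=> x /=; apply: reindex_eq; try exact: (ha (inl _)).
    exact: (ha (inr x)).
  + case=> x /=; apply: reindex_eq; try exact: (hb (inl _)).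
    exact: (hb (inr x)).
- exists fV, fE, fI, fO, (@sub_map _ _ _ iIO f), fL; split => //;
    try exact: sub_map_bij.
  + case=> x /=; apply: reindex_eq; try exact: (ha (inl _)).
      rewrite /= (inj_eq iI); case: ifP => _; [exact: (ha (inr _))|].
      exact: (ha (inl _)).
    exact: (ha (inr (val x))).
  + case=> x /=; apply: reindex_eq; try exact: (hb (inr _)).
    exact: (hb (inl _)).
- exists fV, fE, fI, fO, (@sub_map _ _ _ iIO e), fL; split => //;
    try exact: sub_map_bij.
  + case=> x /=; apply: reindex_eq; try exact: (ha (inr _)).
    exact: (ha (inl _)).
  + case=> x /=; apply: reindex_eq; try exact: (hb (inl _)).
      rewrite /= (inj_eq iO); case: ifP => _; [exact: (hb (inr _))|].
      exact: (hb (inl _)).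
    exact: (hb (inr (val x))).
- have [gL' bL'] : exists g : gL (glue_IO_IO e f) -> gL (glue_IO_IO (fIO e) (fIO f)),
      bijective g.
    rewrite /= (inj_eq iIO); case: (e == f); last by exists fL.
    by exists (option_map fL); exact: option_map_bij.
  exists fV, fE, fI, fO, (@sub_map _ _ _ iIO e), gL'; split => //;
    try exact: sub_map_bij.
  + case=> x /=; apply: reindex_eq; try exact: (ha (inr _)).
    exact: (ha (inl _)).
  + case=> x /=; apply: reindex_eq; try exact: (hb (inr _)).
      exact: (hb (inl _)).
    rewrite /= (inj_eq iIO); case: ifP => _; exact: (hb (inr _)).
Qed.

Lemma graph_ptr_iso (k l : nat) (G H : graph k.+1 l.+1) (i : 'I_k.+1)
    (j : 'I_l.+1) :
  graph_iso G H -> graph_iso (graph_ptr G i j) (graph_ptr H i j).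
Proof.
case=> fV [fE [fI [fO [fIO [fL h]]]]].
have [_ _ _ _ _ _ _ _ ha hb] := h.
rewrite /graph_ptr.
have -> : bij_preim (galpha_bij H) i
    = sum_map fI fIO (bij_preim (galpha_bij G) i).
  by apply: (bij_inj (galpha_bij H)); rewrite ha !bij_preimK.
have -> : bij_preim (gbeta_bij H) j
    = sum_map fO fIO (bij_preim (gbeta_bij G) j).
  by apply: (bij_inj (gbeta_bij H)); rewrite hb !bij_preimK.
exact: glue_iso h.
Qed.

(** * The TraP of graphs *)

Section Gr.
Variable K : fieldType.

Section LinearExtension.
Variables (T : choiceType) (M : lmodType K).

Definition linext (f : T -> M) (x : {malg K[T]}) : M :=
  \sum_(c <- msupp x) x@_c *: f c.

Lemma linext_basis (f : T -> M) (c : T) : linext f (mkmalgU c 1) = f c.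
Proof. by rewrite /linext msuppU oner_eq0 big_seq_fset1 mcoeffUU scale1r. Qed.

Lemma linextEw (f : T -> M) (x : {malg K[T]}) (D : {fset T}) :
  (msupp x `<=` D)%fset -> linext f x = \sum_(c <- D) x@_c *: f c.
Proof.
move=> sD; rewrite /linext (big_fset_incl _ sD) // => c _ /mcoeff_outdom ->.
by rewrite scale0r.
Qed.

Lemma linext_linear (f : T -> M) : linear (linext f).
Proof.
move=> a x y.
have sD : (msupp (a *: x + y) `<=` msupp x `|` msupp y)%fset.
  apply: (fsubset_trans (msuppD_le _ _)).
  by apply: fsetUSS (fsubset_refl _); exact: msuppZ_le.
rewrite (linextEw _ sD) (linextEw _ (fsubsetUl (msupp x) (msupp y))).
rewrite (linextEw _ (fsubsetUr (msupp x) (msupp y))) scaler_sumr -big_split /=.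
by apply: eq_bigr => c _; rewrite mcoeffD mcoeffZ scalerDl scalerA.
Qed.

End LinearExtension.

Definition gr_car (k l : nat) : lmodType K := {malg K[isoclass k l]}.

(** The basis element given by the isoclass of [G]. *)
Definition gr_of (k l : nat) (G : graph k l) : gr_car k l :=
  mkmalgU (class_of_graph G) 1.

Definition Gr : trap_ops K :=
  @TrapOps K gr_car
    (fun k l s => linext (fun c => gr_of (graph_actl (graph_of_class c) s)))
    (fun k l x t =>
       linext (fun c => gr_of (graph_actr (graph_of_class c) t)) x)
    (fun k l k' l' x y =>
       linext (fun c => linext (fun d =>
         gr_of (graph_cat (graph_of_class c) (graph_of_class d))) y) x)
    (gr_of empty_graph)
    (fun k l i j =>
       linext (fun c => gr_of (graph_ptr (graph_of_class c) i j)))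
    (gr_of wire_graph).

End Gr.

Section GrBasis.
Variable K : fieldType.

Lemma gr_of_eq (k l : nat) (G H : graph k l) :
  graph_iso G H -> gr_of K G = gr_of K H.
Proof. by move=> /class_of_graphP h; rewrite /gr_of h. Qed.

Lemma graph_of_class_iso (k l : nat) (G : graph k l) :
  graph_iso (graph_of_class (class_of_graph G)) G.
Proof. by apply/class_of_graphP; rewrite graph_of_classK. Qed.

Lemma gr_actl (k l : nat) (G : graph k l) (s : 'S_l) :
  actl s (gr_of K G : Gr K k l) = gr_of K (graph_actl G s).
Proof.
rewrite /= linext_basis; apply: gr_of_eq.
exact: graph_actl_iso (graph_of_class_iso G).
Qed.

Lemma gr_actr (k l : nat) (G : graph k l) (t : 'S_k) :
  actr (gr_of K G : Gr K k l) t = gr_of K (graph_actr G t).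
Proof.
rewrite /= linext_basis; apply: gr_of_eq.
exact: graph_actr_iso (graph_of_class_iso G).
Qed.

Lemma gr_hcat (k l k' l' : nat) (G : graph k l) (H : graph k' l') :
  hcat (gr_of K G : Gr K k l) (gr_of K H : Gr K k' l')
  = gr_of K (graph_cat G H).
Proof.
rewrite /= !linext_basis; apply: gr_of_eq.
exact: graph_cat_iso (graph_of_class_iso G) (graph_of_class_iso H).
Qed.

Lemma gr_ptr (k l : nat) (G : graph k.+1 l.+1) (i : 'I_k.+1) (j : 'I_l.+1) :
  ptr i j (gr_of K G : Gr K k.+1 l.+1) = gr_of K (graph_ptr G i j).
Proof.
rewrite /= linext_basis; apply: gr_of_eq.
exact: graph_ptr_iso (graph_of_class_iso G).
Qed.

End GrBasis.

(* Main.v *)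
Require Import Defs.
From HB Require Import structures.
From Stdlib Require Import Eqdep_dec.
From mathcomp Require Import all_boot all_fingroup all_algebra.
From mathcomp Require Import boolp finmap monalg zify.

(** Elements of a TraP are considered up to permutation with labels, taken in
    arbitrary sets, on their inputs and outputs.  For such labelled elements the
    horizontal concatenation is a commutative monoid law, traces are indexed by
    labels and commute, and tracing a wire against another element amounts to a
    change of label.  A graph whose internal edges are cut is the unordered
    concatenation of one corolla per vertex, one wire per input-output edge and
    the loops; its image is obtained by replacing the corolla [G_(k,l)] by
    [x k l] and tracing back the cut edges, which involves no choice.  Uniqueness
    is an induction on the size of the graph: cutting internal edges and loops,
    then splitting off vertices and wires, reduces to corollas. *)

Set Implicit Arguments.
Unset Strict Implicit.
Unset Printing Implicit Defensive.

Import GRing.Theory.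
Local Open Scope quotient_scope.

(** * Labelled elements *)

(** Labels may repeat, so that concatenation is total; the price is that a trace makes sense only at
    labels occurring exactly once, and every computation with traces carries a count of labels. When
    all labels are distinct, only the identity permutation preserves them, and the element of
    [P k l] underneath can be recovered ([mk_inj]). Hence the value of a graph is pinned down by any
    injective labelling of its cut edges and external indices, and each compatibility is proved by
    choosing labels for which both sides have the same pieces: permuting indices, or renumbering
    them after a gluing, is only another choice of labels. The invariance of [x k l] is applied in
    [mk_lcor]: the half-edges at a vertex come without an order. Gluing two half-edges at vertices
    just adds one trace to the list, whereas gluing an input-output edge requires commuting the new
    trace past all the others until it meets the wire. *)

Section CatFun.
Variable T : Type.

Definition cat_fun k k' (a : 'I_k -> T) (a' : 'I_k' -> T) (i : 'I_(k + k')) : T :=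
  match split i with inl x => a x | inr x => a' x end.

Lemma cat_funl k k' (a : 'I_k -> T) (a' : 'I_k' -> T) i :
  cat_fun a a' (lshift k' i) = a i.
Proof. by rewrite /cat_fun (unsplitK (inl i)). Qed.

Lemma cat_funr k k' (a : 'I_k -> T) (a' : 'I_k' -> T) i :
  cat_fun a a' (rshift k i) = a' i.
Proof. by rewrite /cat_fun (unsplitK (inr i)). Qed.

Lemma cat_fun1_0 (u : T) k (a : 'I_k -> T) : cat_fun (fun _ : 'I_1 => u) a ord0 = u.
Proof.
have -> : ord0 = lshift k (@ord0 0) by exact: val_inj.
by rewrite cat_funl.
Qed.

Lemma cat_fun1_lift (u : T) k (a : 'I_k -> T) x :
  cat_fun (fun _ : 'I_1 => u) a (lift ord0 x) = a x.
Proof.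
have -> : lift ord0 x = rshift 1 x by exact: val_inj.
by rewrite cat_funr.
Qed.

Definition no_fun (i : 'I_0) : T := match notF (ltn_ord i) with end.

Lemma cat_funP k k' (a : 'I_k -> T) (a' : 'I_k' -> T) f :
  (forall i, f (lshift k' i) = a i) -> (forall i, f (rshift k i) = a' i) ->
  f = cat_fun a a'.
Proof.
move=> hl hr; apply/funext => i; rewrite -[i]splitK.
by case: (split i) => x /=; rewrite ?hl ?hr ?cat_funl ?cat_funr.
Qed.

Lemma cat_fun_tensor k k' (a : 'I_k -> T) (a' : 'I_k' -> T) s t :
  cat_fun a a' \o tensor_perm s t = cat_fun (a \o s) (a' \o t).
Proof.
apply: cat_funP => i /=.
  by rewrite permE (unsplitK (inl i)) /= cat_funl.
by rewrite permE (unsplitK (inr i)) /= cat_funr.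
Qed.

Lemma cat_fun_block k k' (a : 'I_k -> T) (a' : 'I_k' -> T) :
  cat_fun a' a \o cast_ord (addnC k k') \o block_perm k k' = cat_fun a a'.
Proof.
apply: cat_funP => i /=; rewrite permE.
  rewrite (unsplitK (inl i)) /= -[RHS](cat_funr a' a).
  by congr cat_fun; apply: val_inj.
rewrite (unsplitK (inr i)) /= -[RHS](cat_funl a' a).
by congr cat_fun; apply: val_inj.
Qed.

Lemma cat_funA k k' k'' (a : 'I_k -> T) (a' : 'I_k' -> T) (a'' : 'I_k'' -> T) :
  cat_fun a (cat_fun a' a'') \o cast_ord (esym (addnA k k' k''))
  = cat_fun (cat_fun a a') a''.
Proof.
apply: cat_funP => i /=; last first.
  rewrite -[RHS](cat_funr a') -[RHS](cat_funr a).
  by congr cat_fun; apply: val_inj; rewrite /= addnA.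
rewrite -[i]splitK; case: (split i) => x /=; rewrite ?cat_funl ?cat_funr.
  by rewrite -[RHS](cat_funl _ (cat_fun a' a'')); congr cat_fun; apply: val_inj.
rewrite -[RHS](cat_funl _ a'') -[RHS](cat_funr a).
by congr cat_fun; apply: val_inj.
Qed.

Lemma cat0_fun k (a : 'I_k -> T) : cat_fun no_fun a = a.
Proof.
by apply/esym/cat_funP => i; [case: i | congr (a _); exact: val_inj].
Qed.

Lemma eq_no_fun (a : 'I_0 -> T) : a = no_fun.
Proof. by apply/funext => i; case: i. Qed.

End CatFun.

(** Read through [lift], which undoes the renumbering, [del_perm] is just [s] restricted to the
    complement of one position; labels then follow by composition. *)
Lemma lift_del_perm n (s : 'S_n.+1) p x :
  lift p (del_perm s p x) = s (lift ((s^-1)%g p) x).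
Proof. by rewrite permE lift_shrink. Qed.

(** The wire axioms are applied only at the first index, where their cycle has a single letter;
    other indices are brought there by a transposition. *)
Lemma cycle_upto0 n : cycle_upto (@ord0 n) = 1%g.
Proof.
rewrite /cycle_upto enum_ordSl /= filter_map.
rewrite (eq_filter (a2 := pred0)) // filter_pred0 /=.
by apply/permP => x; rewrite permE perm1 /= ; case: eqP => [->|].
Qed.

(** * Multiplicities of labels *)

Section CountFun.
Variable T : eqType.

Lemma sum_eq_count k (a : 'I_k -> T) y :
  (\sum_(i < k) (a i == y))%N = count_mem y [seq a i | i <- enum 'I_k].
Proof.
rewrite count_map -sum1_count big_enum_cond [RHS]big_mkcond.
by apply: eq_bigr => i _ /=; case: (a i == y).
Qed.

(** Equal multiplicities make the two words of labels permutations of each other; comparing their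
    sizes yields [k' = k], which is not assumed. *)
Lemma eq_count_perm k k' (a : 'I_k -> T) (a' : 'I_k' -> T) :
  (forall y, (\sum_(i < k) (a i == y) = \sum_(i < k') (a' i == y))%N) ->
  exists (e : k' = k) (t : 'S_k), a = a' \o cast_ord (esym e) \o t.
Proof.
move=> h.
have pe : perm_eq [seq a i | i <- enum 'I_k] [seq a' i | i <- enum 'I_k'].
  by apply/allP => y _ /=; rewrite -!sum_eq_count h.
have e : k' = k.
  by have := perm_size pe; rewrite 2!size_map !size_enum_ord.
subst k'; exists erefl.
have /tuple_permP [t et] : perm_eq (mktuple a) (mktuple a') by [].
exists t; apply/funext => i /=.
have := congr1 (fun s => tnth s i) (val_inj et).
by rewrite !tnth_mktuple => ->; congr a'; apply: val_inj.
Qed.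

End CountFun.

Lemma sum_eq1 (I : finType) (A : eqType) (a : I -> A) i i' :
  (\sum_j (a j == a i) = 1)%N -> a i' = a i -> i' = i.
Proof.
rewrite (bigD1 i) //= eqxx => -[] /eqP; rewrite sum_nat_eq0 => /forallP/(_ i').
move=> h e; apply/eqP; apply: contraT => ne.
by move: h; rewrite ne e eqxx.
Qed.

Lemma sum_inj1 (I : finType) (A : eqType) (f : I -> A) i :
  injective f -> (\sum_j (f j == f i) = 1)%N.
Proof.
move=> fi; rewrite (bigD1 i) //= eqxx big1 // => j ne.
by rewrite (inj_eq fi) (negPf ne).
Qed.

Lemma sum_eq1_ex (I : finType) (A : eqType) (a : I -> A) y :
  (\sum_i (a i == y) = 1)%N -> exists i, a i = y.
Proof.
move=> h; have [i /eqP <-|none] := pickP (fun i => a i == y); first by exists i.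
by move: h; rewrite big1 // => i _; rewrite none.
Qed.

Lemma cat_fun_comp (T T' : Type) (f : T -> T') k k' (a : 'I_k -> T)
    (a' : 'I_k' -> T) :
  f \o cat_fun a a' = cat_fun (f \o a) (f \o a').
Proof. by apply: cat_funP => i /=; rewrite ?cat_funl ?cat_funr. Qed.

Section Labelled.
Variables (K : fieldType) (P : trap K).
Let ax := trap_axioms P.

(** * Labelled elements modulo permutation, their concatenation and traces *)

Section LabelTypes.
Variables T U : eqType.

(** The arities are fields, not parameters: elements of all arities live in one type, so the casts
    of [hcatA] and [hcatC] disappear into the labels. *)
Record lrep := LRep {
  lk : nat;
  ll : nat;
  lp : P lk ll;
  lin : 'I_lk -> T;
  lout : 'I_ll -> U
}.
Arguments lin : clear implicits.
Arguments lout : clear implicits.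

(** The components depend on the arities; since equality on [nat] is decidable, equalities of
    dependent pairs can be projected. *)
Lemma LRep_inj k l (p p' : P k l) a a' b b' :
  LRep p a b = LRep p' a' b' -> [/\ p = p', a = a' & b = b'].
Proof.
have dec : forall x y : nat, {x = y} + {x <> y} by exact: eq_comparable.
case=> ep ea eb; split.
- have := inj_pair2_eq_dec _ dec _ _ _ _ ep; exact: inj_pair2_eq_dec.
- exact: inj_pair2_eq_dec ea.
- exact: inj_pair2_eq_dec eb.
Qed.

(** Each label stays with its edge: input [i] of the new element was input [t i], and output [i] was
    output [s^-1 i]. *)
Definition lact (r : lrep) (s : 'S_(ll r)) (t : 'S_(lk r)) : lrep :=
  LRep (actl s (actr (lp r) t)) (lin r \o t) (lout r \o (s^-1)%g).

Definition lrep_eq (r r' : lrep) : bool :=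
  `[< exists s t, r' = @lact r s t >].

Lemma lrep_eq_equiv : equiv_class_of lrep_eq.
Proof.
have sym r r' : lrep_eq r r' -> lrep_eq r' r.
  case: r => k l p a b /asboolP [s [t ->]]; apply/asboolP.
  exists (s^-1)%g, (t^-1)%g; rewrite /lact /=.
  rewrite (actlr ax) -(actlM ax) mulgV (actl1 ax) -(actrM ax) mulVg.
  rewrite (actr1 ax) invgK.
  by congr LRep; apply/funext => i /=; rewrite ?permKV ?permK.
split.
- case=> k l p a b; apply/asboolP; exists 1%g, 1%g.
  rewrite /lact /= (actr1 ax) (actl1 ax) invg1.
  by congr LRep; apply/funext => i /=; rewrite perm1.
- by move=> r r'; apply/idP/idP; exact: sym.
- move=> r2 [k l p a b] r /asboolP [s [t ->]] /asboolP [s' [t' ->]].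
  apply/asboolP; exists (s * s')%g, (t' * t)%g; rewrite /lact /=.
  rewrite (actlr ax) -(actlM ax) -(actrM ax) invMg.
  by congr LRep; apply/funext => i /=; rewrite permM.
Qed.

HB.instance Definition _ := gen_eqMixin lrep.
HB.instance Definition _ := gen_choiceMixin lrep.
Canonical lrep_eq_rel := EquivRelPack lrep_eq_equiv.

(** The input [i] of [p] carries the label [a i]; labels may be repeated. *)
Definition lab := {eq_quot lrep_eq}.

Definition mk k l (p : P k l) (a : 'I_k -> T) (b : 'I_l -> U) : lab :=
  \pi_lab (LRep p a b).

Lemma labP (X : lab) : exists k l (p : P k l) a b, X = mk p a b.
Proof.
rewrite -[X]reprK; case: (generic_quotient.repr X) => k l p a b.
by exists k, l, p, a, b.
Qed.

Lemma mkP k l (p : P k l) a b (r : lrep) :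
  mk p a b = \pi_lab r ->
  exists s t, r = LRep (actl s (actr p t)) (a \o t) (b \o (s^-1)%g).
Proof. by move/eqquotP/asboolP => -[s [t ->]]; exists s, t. Qed.

Lemma mk_eq k l (p p' : P k l) a a' b b' :
  mk p a b = mk p' a' b' ->
  exists s t, [/\ p' = actl s (actr p t), a' = a \o t & b' = b \o (s^-1)%g].
Proof. by move=> /mkP [s [t /LRep_inj [-> -> ->]]]; exists s, t. Qed.

Lemma mk_act k l (p : P k l) a b s t :
  mk (actl s (actr p t)) a b = mk p (a \o (t^-1)%g) (b \o s).
Proof.
apply/esym/eqquotP/asboolP; exists s, t; congr LRep.
  by apply/funext => i /=; rewrite permK.
by apply/funext => i /=; rewrite permKV.
Qed.

Lemma mk_actl k l (p : P k l) a b s : mk (actl s p) a b = mk p a (b \o s).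
Proof.
by rewrite -{1}[p](actr1 ax) mk_act; congr mk; apply/funext=> i /=; rewrite invg1 perm1.
Qed.

Lemma mk_actr k l (p : P k l) a b t : mk (actr p t) a b = mk p (a \o (t^-1)%g) b.
Proof.
by rewrite -[actr p t](actl1 ax) mk_act; congr mk; apply/funext=> i /=; rewrite perm1.
Qed.

Lemma mk_tcast k l k' l' (ek : k = k') (el : l = l') (p : P k l) a b :
  mk (Defs.tcast ek el p) a b = mk p (a \o cast_ord ek) (b \o cast_ord el).
Proof.
by case: _ / ek a; case: _ / el b => b a; congr mk; apply/funext => i /=;
  congr (_ _); apply: val_inj.
Qed.

(** The way back from labelled elements to [P]: permutations relating the two representatives must
    fix injective labels, hence are trivial. *)
Lemma mk_inj k l (p p' : P k l) (a : 'I_k -> T) (b : 'I_l -> U) :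
  injective a -> injective b -> mk p a b = mk p' a b -> p = p'.
Proof.
move=> ia ib /mk_eq [s [t [-> ea eb]]].
have -> : t = 1%g.
  by apply/permP => i; apply: ia; rewrite perm1; exact: esym (congr1 (@^~ i) ea).
suff -> : s = 1%g by rewrite (actr1 ax) (actl1 ax).
apply: invg_inj; rewrite invg1; apply/permP => i; apply: ib.
by rewrite perm1; exact: esym (congr1 (@^~ i) eb).
Qed.

Definition incount_rep (r : lrep) (y : T) : nat := \sum_(i < lk r) (lin r i == y).
Definition outcount_rep (r : lrep) (y : U) : nat := \sum_(i < ll r) (lout r i == y).
Definition incount (X : lab) := incount_rep (generic_quotient.repr X).
Definition outcount (X : lab) := outcount_rep (generic_quotient.repr X).

Lemma incount_mk k l (p : P k l) a b y :
  incount (mk p a b) y = \sum_(i < k) (a i == y).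
Proof.
rewrite /incount; have /esym := reprK (mk p a b).
move=> /mkP [s [t ->]] /=; rewrite /incount_rep /=.
by rewrite [RHS](reindex_inj (@perm_inj _ t)).
Qed.

Lemma outcount_mk k l (p : P k l) a b y :
  outcount (mk p a b) y = \sum_(i < l) (b i == y).
Proof.
rewrite /outcount; have /esym := reprK (mk p a b).
move=> /mkP [s [t ->]] /=; rewrite /outcount_rep /=.
by rewrite [RHS](reindex_inj (@perm_inj _ (s^-1)%g)).
Qed.

Definition lcat (X Y : lab) : lab :=
  let r := generic_quotient.repr X in let r' := generic_quotient.repr Y in
  mk (hcat (lp r) (lp r')) (cat_fun (lin r) (lin r')) (cat_fun (lout r) (lout r')).

(** Independence of the chosen representatives: [hcat_act] gathers the permutations of both factors
    into tensor permutations, which move to the labels. *)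
Lemma lcat_mk k l k' l' (p : P k l) (p' : P k' l') a b a' b' :
  lcat (mk p a b) (mk p' a' b') = mk (hcat p p') (cat_fun a a') (cat_fun b b').
Proof.
rewrite /lcat; have /esym/mkP [s [t ->]] := reprK (mk p a b).
have /esym/mkP [s' [t' ->]] /= := reprK (mk p' a' b').
rewrite -!(actlr ax) (hcat_act ax) (actlr ax) mk_act; congr mk.
  by rewrite -cat_fun_tensor; apply/funext => i /=; rewrite permKV.
by rewrite cat_fun_tensor; congr cat_fun; apply/funext => i /=; rewrite permK.
Qed.

Definition lone : lab := mk (hunit P) (@no_fun T) (@no_fun U).

Lemma lcatA : associative lcat.
Proof.
move=> X Y Z; have [k [l [p [a [b ->]]]]] := labP X.
have [k' [l' [p' [a' [b' ->]]]]] := labP Y.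
have [k'' [l'' [p'' [a'' [b'' ->]]]]] := labP Z.
by rewrite !lcat_mk -(hcatA ax) mk_tcast !cat_funA.
Qed.

(** The block permutations of [hcatC] are absorbed by the labels. Strict commutativity is what
    permits big operators over unordered sets of vertices and edges. *)
Lemma lcatC : commutative lcat.
Proof.
move=> X Y; have [k [l [p [a [b ->]]]]] := labP X.
have [k' [l' [p' [a' [b' ->]]]]] := labP Y.
rewrite !lcat_mk; have := hcatC ax p p'.
move=> /(congr1 (fun q => mk q (cat_fun a a')
  (cat_fun b' b \o cast_ord (addnC l l')))).
rewrite mk_actr mk_actl cat_fun_block mk_tcast => ->; congr mk.
  rewrite -cat_fun_block; apply/funext => i /=; rewrite permKV.
  by congr cat_fun; apply: val_inj.
by apply/funext => i /=; congr cat_fun; apply: val_inj.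
Qed.

Lemma lcat1 : left_id lone lcat.
Proof.
move=> X; have [k [l [p [a [b ->]]]]] := labP X.
by rewrite lcat_mk (hcat0p ax) !cat0_fun.
Qed.

HB.instance Definition _ := Monoid.isComLaw.Build lab lone lcat lcatA lcatC lcat1.

Lemma incount_lcat X Y y : incount (lcat X Y) y = (incount X y + incount Y y)%N.
Proof.
have [k [l [p [a [b ->]]]]] := labP X; have [k' [l' [p' [a' [b' ->]]]]] := labP Y.
rewrite lcat_mk !incount_mk big_split_ord /=.
by congr addn; apply: eq_bigr => i _; rewrite ?cat_funl ?cat_funr.
Qed.

Lemma outcount_lcat X Y y : outcount (lcat X Y) y = (outcount X y + outcount Y y)%N.
Proof.
have [k [l [p [a [b ->]]]]] := labP X; have [k' [l' [p' [a' [b' ->]]]]] := labP Y.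
rewrite lcat_mk !outcount_mk big_split_ord /=.
by congr addn; apply: eq_bigr => i _; rewrite ?cat_funl ?cat_funr.
Qed.

Lemma incount_lone y : incount lone y = 0%N.
Proof. by rewrite incount_mk big_ord0. Qed.

Lemma outcount_lone y : outcount lone y = 0%N.
Proof. by rewrite outcount_mk big_ord0. Qed.

Lemma incount_big (I : Type) (s : seq I) (F : I -> lab) y :
  incount (\big[lcat/lone]_(i <- s) F i) y = (\sum_(i <- s) incount (F i) y)%N.
Proof.
exact: (big_morph (incount^~ y) (fun X Y => incount_lcat X Y y) (incount_lone y)).
Qed.

Lemma outcount_big (I : Type) (s : seq I) (F : I -> lab) y :
  outcount (\big[lcat/lone]_(i <- s) F i) y = (\sum_(i <- s) outcount (F i) y)%N.
Proof.
exact: (big_morph (outcount^~ y) (fun X Y => outcount_lcat X Y y) (outcount_lone y)).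
Qed.

(** The permutations that match the labels of a representative with [a] and [b] can be moved onto
    the element. This imposes the ordered inputs and outputs on the result of a computation with
    labels. *)
Lemma mk_normal k l (a : 'I_k -> T) (b : 'I_l -> U) (X : lab) :
  (forall y, incount X y = \sum_(i < k) (a i == y))%N ->
  (forall y, outcount X y = \sum_(i < l) (b i == y))%N ->
  exists p, X = mk p a b.
Proof.
have [k' [l' [p [a' [b' ->]]]]] := labP X => ha hb.
have [|ek [t et]] := @eq_count_perm _ k k' a a'.
  by move=> y; rewrite -ha incount_mk.
have [|el [s es]] := @eq_count_perm _ l l' b b'.
  by move=> y; rewrite -hb outcount_mk.
subst k' l'; exists (actl (s^-1)%g (actr p t)).
rewrite mk_act et es; congr mk; apply/funext => i /=; rewrite permKV;
  by congr (_ _); apply: val_inj.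
Qed.

(** A relation rather than a function of a representative: [ptr] requires successor arities and
    positions, which exist only if both labels occur. *)
Definition is_ltr (e : T) (f : U) (X Y : lab) : Prop :=
  exists k l (p : P k.+1 l.+1) a b i j,
    [/\ X = mk p a b, a i = e, b j = f
      & Y = mk (ptr i j p) (a \o lift i) (b \o lift j)].

Definition once (e : T) (f : U) (X : lab) : bool :=
  (incount X e == 1)%N && (outcount X f == 1)%N.

Lemma is_ltr_uniq e f X Y Y' :
  once e f X -> is_ltr e f X Y -> is_ltr e f X Y' -> Y = Y'.
Proof.
move=> /andP [/eqP ce /eqP cf] [k [l [p [a [b [i [j [eX ae bf ->]]]]]]]].
move=> [k' [l' [p' [a' [b' [i' [j' [eX' ae' bf' ->]]]]]]]].
move: eX'; rewrite eX => /mkP [s [t]] eq.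
have [ek el] : k' = k /\ l' = l by move: (congr1 lk eq) (congr1 ll eq) => /= [->] [->].
subst k' l'; move/LRep_inj: eq => -[ep ea eb].
rewrite eX incount_mk outcount_mk in ce cf *.
have et : t i' = i.
  by apply: (@sum_eq1 _ _ a); rewrite ?ae // -ae' ea.
have es : (s^-1)%g j' = j.
  by apply: (@sum_eq1 _ _ b); rewrite ?bf // -bf' eb.
(* By [ptr_act] the permutations cross the trace as [del_perm], and [lift_del_perm] matches these
   with the labels that survive the deletion. *)
rewrite ep -(actlr ax) (ptr_act ax) et es (actlr ax) mk_act ea eb; congr mk.
  apply/funext => x /=; rewrite -[x in LHS](permKV (del_perm t i)).
  by rewrite lift_del_perm -et permK.
by apply/funext => x /=; rewrite lift_del_perm permK es.
Qed.

(** The identity unless both labels occur exactly once. *)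
Definition ltr (e : T) (f : U) (X : lab) : lab :=
  if pselect (exists Y, once e f X /\ is_ltr e f X Y) is left h
  then projT1 (cid h) else X.

Lemma ltr_mk k l (p : P k.+1 l.+1) a b i j :
  once (a i) (b j) (mk p a b) ->
  ltr (a i) (b j) (mk p a b) = mk (ptr i j p) (a \o lift i) (b \o lift j).
Proof.
move=> h.
have h' : is_ltr (a i) (b j) (mk p a b) (mk (ptr i j p) (a \o lift i) (b \o lift j)).
  by exists k, l, p, a, b, i, j.
rewrite /ltr; case: pselect => [h''|[]]; last by eexists; split; [exact: h|exact: h'].
by case: (cid h'') => Y [_ hY] /=; exact: is_ltr_uniq hY h'.
Qed.

Lemma once_mk e f k l (p : P k l) a b : once e f (mk p a b) ->
  (exists i, a i = e) /\ (exists j, b j = f).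
Proof.
rewrite /once incount_mk outcount_mk => /andP [/eqP h /eqP h'].
by split; exact: sum_eq1_ex.
Qed.

Lemma ltrP e f X : once e f X -> exists k l (p : P k.+1 l.+1) a b i j,
  [/\ X = mk p a b, a i = e & b j = f].
Proof.
have [k [l [p [a [b ->]]]]] := labP X => /once_mk [[i ae] [j bf]].
case: k p a i ae => [|k] p a i ae; first by case: i {ae}.
case: l p b j bf => [|l] p b j bf; first by case: j {bf}.
by exists k, l, p, a, b, i, j.
Qed.

Lemma incount_ltr e f X y : once e f X ->
  incount X y = ((e == y) + incount (ltr e f X) y)%N.
Proof.
move=> h; have [k [l [p [a [b [i [j [eX ae bf]]]]]]]] := ltrP h.
move: h; rewrite eX -ae -bf => h; rewrite ltr_mk // !incount_mk.
by rewrite (bigD1_ord i).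
Qed.

Lemma outcount_ltr e f X y : once e f X ->
  outcount X y = ((f == y) + outcount (ltr e f X) y)%N.
Proof.
move=> h; have [k [l [p [a [b [i [j [eX ae bf]]]]]]]] := ltrP h.
move: h; rewrite eX -ae -bf => h; rewrite ltr_mk // !outcount_mk.
by rewrite (bigD1_ord j).
Qed.

(** The vanishing counts in [Y] keep [e] and [f] unique in the concatenation; the trace then takes
    place inside the left factor by [ptr_hcatl]. *)
Lemma ltr_catl e f X Y : once e f X -> incount Y e = 0%N -> outcount Y f = 0%N ->
  ltr e f (lcat X Y) = lcat (ltr e f X) Y.
Proof.
move=> h hY hY'; have [k [l [p [a [b [i [j [eX ae bf]]]]]]]] := ltrP h.
have [k' [l' [p' [a' [b' eY]]]]] := labP Y.
have h2 : once e f (lcat X Y).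
  by rewrite /once incount_lcat outcount_lcat hY hY' !addn0.
move: h h2; rewrite eX eY -ae -bf lcat_mk => h h2.
rewrite ltr_mk // lcat_mk -(ptr_hcatl ax).
have := @ltr_mk (k + k') (l + l') (hcat p p') (cat_fun a a') (cat_fun b b')
  (lshift k' i) (lshift l' j).
rewrite !cat_funl => -> //; congr mk; apply: cat_funP => x /=.
- rewrite -[a _](cat_funl _ a'); congr cat_fun; exact: val_inj.
- rewrite -[a' _](cat_funr a); congr cat_fun; apply: val_inj => /=.
  by rewrite /bump (leq_trans (leq_ord i) (leq_addr _ _)) add1n addSn.
- rewrite -[b _](cat_funl _ b'); congr cat_fun; exact: val_inj.
- rewrite -[b' _](cat_funr b); congr cat_fun; apply: val_inj => /=.
  by rewrite /bump (leq_trans (leq_ord j) (leq_addr _ _)) add1n addSn.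
Qed.

(** The two cases are those of the axioms on consecutive partial traces. *)
Lemma lift_lift n (i : 'I_n.+2) (x : 'I_n.+1) (i' : 'I_n.+1) :
  lift (lift i x) i' = i ->
  (forall y, lift i (lift x y) = lift (lift i x) (lift i' y)) /\
  (((x < i)%N /\ lift i x = inord x /\ i' = inord i.-1) \/
   ((i <= x)%N /\ lift i x = inord x.+1 /\ i' = inord i)).
Proof.
move=> /(congr1 val) /=; rewrite /bump => e.
have hi := ltn_ord i; have hx := ltn_ord x; have hi' := ltn_ord i'.
split.
  by move=> y; apply: val_inj => /=; rewrite /bump; lia.
have [h|h] := ltnP x i; [left | right]; split=> //; split; apply: val_inj;
  rewrite /= ?inordK /bump //; lia.
Qed.

(** The four axioms on consecutive traces in one form: [lift i i2] is the original position of the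
    second deleted input, and [i'] the position of [i] once that input has been deleted first. *)
Lemma ptrC k l (p : P k.+2 l.+2) (i : 'I_k.+2) (j : 'I_l.+2)
    (i2 i' : 'I_k.+1) (j2 j' : 'I_l.+1) :
  lift (lift i i2) i' = i -> lift (lift j j2) j' = j ->
  ptr i2 j2 (ptr i j p) = ptr i' j' (ptr (lift i i2) (lift j j2) p).
Proof.
move=> /lift_lift [_ [[h [-> ->]]|[h [-> ->]]]];
  move=> /lift_lift [_ [[h' [-> ->]]|[h' [-> ->]]]].
- exact: (ptr_lt_lt ax).
- exact: (ptr_lt_ge ax).
- exact: (ptr_ge_lt ax).
- exact: (ptr_ge_ge ax).
Qed.

Lemma once_ltr e f e' f' X : e != e' -> f != f' -> once e f X -> once e' f' X ->
  once e' f' (ltr e f X).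
Proof.
move=> ne nf h /andP [h1 h2]; move: h1 h2.
rewrite (incount_ltr _ h) (outcount_ltr _ h) (negPf ne) (negPf nf) !add0n.
by rewrite /once => -> ->.
Qed.

Lemma ltrC e f e' f' X : e != e' -> f != f' -> once e f X -> once e' f' X ->
  ltr e' f' (ltr e f X) = ltr e f (ltr e' f' X).
Proof.
move=> ne nf h h'; have [k [l [p [a [b [i [j [eX ae bf]]]]]]]] := ltrP h.
have h1 := once_ltr ne nf h h'.
rewrite eq_sym in ne; rewrite eq_sym in nf; have h2 := once_ltr ne nf h' h.
move: h h' h1 h2; rewrite eX -ae -bf => h h' h1 h2.
have [[i2 ai2] [j2 bj2]] := once_mk h'.
have /unlift_some [x ex _] : i != i2.
  by apply: contraNneq ne => e0; rewrite -ai2 -ae e0.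
have /unlift_some [y ey _] : j != j2.
  by apply: contraNneq nf => e0; rewrite -bj2 -bf e0.
have /unlift_some [x' ex' _] : i2 != i.
  by apply: contraNneq ne => e0; rewrite -ai2 -ae e0.
have /unlift_some [y' ey' _] : j2 != j.
  by apply: contraNneq nf => e0; rewrite -bj2 -bf e0.
(* The position [x] lies in ['I_k], which forces [k] to be a successor, as [ptrC] requires; likewise
   for [l] and [y]. *)
case: k p a i i2 x x' ae ai2 ex ex' eX h h' h1 h2
  => [|k] p a i i2 x x' ae ai2 ex ex' eX h h' h1 h2.
  by case: x {ex ex'}.
case: l p b j j2 y y' bf bj2 ey ey' eX h h' h1 h2
  => [|l] p b j j2 y y' bf bj2 ey ey' eX h h' h1 h2.
  by case: y {ey ey'}.
move: h h' h1 h2; rewrite -ai2 -bj2 => h h' h1 h2.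
rewrite (ltr_mk h) (ltr_mk h') in h1 h2 *.
have := ltr_mk (p := ptr i j p) (a := a \o lift i) (b := b \o lift j) (i := x) (j := y).
rewrite /= -ex -ey => -> //.
have := ltr_mk (p := ptr i2 j2 p) (a := a \o lift i2) (b := b \o lift j2) (i := x')
  (j := y').
rewrite /= -ex' -ey' => -> //.
have ei : lift (lift i x) x' = i by rewrite -ex.
have ej : lift (lift j y) y' = j by rewrite -ey.
rewrite (ptrC _ ei ej) -ex -ey.
have [hi _] := lift_lift ei; have [hj _] := lift_lift ej.
by congr mk; apply/funext => z /=; rewrite ?hi ?hj -?ex -?ey.
Qed.

End LabelTypes.
Arguments lin {T U} _ _.
Arguments lout {T U} _ _.

(** * Change of labels *)

Section LabelMap.
Variables (T U T' U' : eqType) (f : T -> T') (g : U -> U').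

Definition lmap (X : lab T U) : lab T' U' :=
  let r := generic_quotient.repr X in mk (lp r) (f \o lin r) (g \o lout r).

Lemma lmap_mk k l (p : P k l) a b : lmap (mk p a b) = mk p (f \o a) (g \o b).
Proof.
rewrite /lmap; have /esym/mkP [s [t ->]] /= := reprK (mk p a b).
by rewrite mk_act; congr mk; apply/funext => i /=; rewrite ?permKV ?permK.
Qed.

Lemma lmap_lcat X Y : lmap (lcat X Y) = lcat (lmap X) (lmap Y).
Proof.
have [k [l [p [a [b ->]]]]] := labP X; have [k' [l' [p' [a' [b' ->]]]]] := labP Y.
by rewrite lcat_mk !lmap_mk lcat_mk !cat_fun_comp.
Qed.

Lemma lmap_lone : lmap (@lone T U) = @lone T' U'.
Proof. by rewrite lmap_mk; congr mk; exact: eq_no_fun. Qed.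

Lemma lmap_big (I : Type) (s : seq I) (F : I -> lab T U) :
  lmap (\big[@lcat T U/@lone T U]_(i <- s) F i)
  = \big[@lcat T' U'/@lone T' U']_(i <- s) lmap (F i).
Proof. exact: (big_morph lmap lmap_lcat lmap_lone). Qed.

Hypotheses (fi : injective f) (gi : injective g).

Lemma incount_lmap X y : incount (lmap X) (f y) = incount X y.
Proof.
have [k [l [p [a [b ->]]]]] := labP X; rewrite lmap_mk !incount_mk.
by apply: eq_bigr => i _ /=; rewrite (inj_eq fi).
Qed.

Lemma outcount_lmap X y : outcount (lmap X) (g y) = outcount X y.
Proof.
have [k [l [p [a [b ->]]]]] := labP X; rewrite lmap_mk !outcount_mk.
by apply: eq_bigr => i _ /=; rewrite (inj_eq gi).
Qed.

Lemma once_lmap X e u : once (f e) (g u) (lmap X) = once e u X.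
Proof. by rewrite /once incount_lmap outcount_lmap. Qed.

(** Injective maps preserve multiplicities, so the condition [once] survives and the same positions
    are traced on both sides. *)
Lemma ltr_lmap X e u : once e u X -> ltr (f e) (g u) (lmap X) = lmap (ltr e u X).
Proof.
move=> h; have [k [l [p [a [b [i [j [eX ae bu]]]]]]]] := ltrP h.
have := h; rewrite -once_lmap; move: h; rewrite eX lmap_mk -ae -bu => h h'.
by rewrite (ltr_mk h) lmap_mk; exact: ltr_mk h'.
Qed.

End LabelMap.

(** * Wires and loops *)

Section Wires.
Variables T U : eqType.
Implicit Type X : lab T U.

Definition relabel (A : eqType) (f u y : A) : A := if y == f then u else y.

Definition lwire (e : T) (u : U) : lab T U := mk (wire P) (fun=> e) (fun=> u).

Lemma incount_lwire e u y : incount (lwire e u) y = (e == y).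
Proof. by rewrite incount_mk big_ord1. Qed.

Lemma outcount_lwire e u y : outcount (lwire e u) y = (u == y).
Proof. by rewrite outcount_mk big_ord1. Qed.

Lemma lift10 n : lift (lift ord0 (@ord0 n)) ord0 = ord0.
Proof. exact: val_inj. Qed.

Lemma lift1S n (x : 'I_n) :
  lift (lift ord0 (@ord0 n)) (lift ord0 x) = lift ord0 (lift ord0 x).
Proof. exact: val_inj. Qed.

(** The output [f] of [X] is plugged into the input of the wire and comes out with the label [u] of
    its other end. If [u] were [f], this label would occur twice in the concatenation. *)
Lemma ltr_wirel e f u X : u != f -> incount X e = 0%N -> outcount X f = 1%N ->
  ltr e f (lcat (lwire e u) X) = lmap id (relabel f u) X.
Proof.
have [k [l [p [a [b ->]]]]] := labP X => ne he hf.
have [j bj] : exists j, b j = f.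
  by apply: sum_eq1_ex; rewrite -hf outcount_mk.
case: l p b j he bj hf => [|l] p b j he bj hf; first by case: j {bj}.
wlog j0 : p b j he bj hf / j = ord0.
  move=> h; have e0 : mk (actl (tperm ord0 j) p) a (b \o tperm ord0 j) = mk p a b.
    by rewrite mk_actl; congr mk; apply/funext => x /=; rewrite tpermK.
  rewrite -e0; apply: (h _ _ ord0) => //; rewrite ?e0 //=.
  by rewrite tpermL.
subst j; have h1 : once e f (lcat (lwire e u) (mk p a b)).
  by rewrite /once incount_lcat outcount_lcat he hf incount_lwire outcount_lwire
    eqxx (negPf ne).
move: h1; rewrite lcat_mk => h1.
have := @ltr_mk T U k l.+1 (hcat (wire P) p) (cat_fun (fun _ : 'I_1 => e) a)
  (cat_fun (fun _ : 'I_1 => u) b) ord0 (lift ord0 ord0).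
rewrite cat_fun1_0 cat_fun1_lift bj => -> //.
rewrite (ptr_wirel_out ax) cycle_upto0 (actl1 ax) lmap_mk; congr mk; apply/funext => x.
  by rewrite /= cat_fun1_lift.
rewrite /= /relabel; case: (unliftP ord0 x) => [y|] ->; last first.
  by rewrite lift10 cat_fun1_0 bj eqxx.
rewrite lift1S cat_fun1_lift ifN //; apply/eqP => by0.
move: hf; rewrite outcount_mk -by0 => hf.
have := sum_eq1 hf (etrans bj (esym by0)).
by move/eqP; rewrite (negPf (neq_lift _ _)).
Qed.

Lemma ltr_wirer e f u X : u != e -> incount X e = 1%N -> outcount X f = 0%N ->
  ltr e f (lcat (lwire u f) X) = lmap (relabel e u) id X.
Proof.
have [k [l [p [a [b ->]]]]] := labP X => ne he hf.
have [i ai] : exists i, a i = e.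
  by apply: sum_eq1_ex; rewrite -he incount_mk.
case: k p a i he ai hf => [|k] p a i he ai hf; first by case: i {ai}.
wlog i0 : p a i he ai hf / i = ord0.
  move=> h; have e0 : mk (actr p (tperm ord0 i)) (a \o tperm ord0 i) b = mk p a b.
    by rewrite mk_actr; congr mk; apply/funext => x /=; rewrite tpermV tpermK.
  rewrite -e0; apply: (h _ _ ord0) => //; rewrite ?e0 //=.
  by rewrite tpermL.
subst i; have h1 : once e f (lcat (lwire u f) (mk p a b)).
  by rewrite /once incount_lcat outcount_lcat he hf incount_lwire outcount_lwire
    eqxx (negPf ne).
move: h1; rewrite lcat_mk => h1.
have := @ltr_mk T U k.+1 l (hcat (wire P) p) (cat_fun (fun _ : 'I_1 => u) a)
  (cat_fun (fun _ : 'I_1 => f) b) (lift ord0 ord0) ord0.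
rewrite cat_fun1_0 cat_fun1_lift ai => -> //.
rewrite (ptr_wirel_in ax) cycle_upto0 invg1 (actr1 ax) lmap_mk.
congr mk; apply/funext => x; last first.
  by rewrite /= cat_fun1_lift.
rewrite /= /relabel; case: (unliftP ord0 x) => [y|] ->; last first.
  by rewrite lift10 cat_fun1_0 ai eqxx.
rewrite lift1S cat_fun1_lift ifN //; apply/eqP => ay0.
move: he; rewrite incount_mk -ay0 => he.
have := sum_eq1 he (etrans ai (esym ay0)).
by move/eqP; rewrite (negPf (neq_lift _ _)).
Qed.

(** The value of a loop: a wire whose input is traced against its own output, with no label left. *)
Definition lloop : lab T U := mk (ptr ord0 ord0 (wire P)) (@no_fun T) (@no_fun U).

Lemma incount_lloop y : incount lloop y = 0%N.
Proof. by rewrite incount_mk big_ord0. Qed.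

Lemma outcount_lloop y : outcount lloop y = 0%N.
Proof. by rewrite outcount_mk big_ord0. Qed.

Lemma ltr_wire e f : ltr e f (lwire e f) = lloop.
Proof.
have h : once e f (lwire e f) by rewrite /once incount_lwire outcount_lwire !eqxx.
rewrite (ltr_mk (i := ord0) (j := ord0) h).
by congr mk; exact: eq_no_fun.
Qed.

End Wires.

Lemma lmap_lwire (T U T' U' : eqType) (f : T -> T') (g : U -> U') e u :
  lmap f g (lwire e u) = lwire (f e) (g u).
Proof. exact: lmap_mk. Qed.

Lemma lmap_lloop (T U T' U' : eqType) (f : T -> T') (g : U -> U') :
  lmap f g (lloop T U) = lloop T' U'.
Proof. by rewrite lmap_mk; congr mk; exact: eq_no_fun. Qed.

(** * Iterated traces in arbitrary order *)

Section IteratedTraces.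
Variables T U : eqType.
Implicit Types (X Y : lab T U) (ps : seq (T * U)).

Definition ltrs ps X := foldr (fun ef => ltr ef.1 ef.2) X ps.

(** Under this condition no trace in [ltrs ps X] falls into the default case of [ltr], as
    [once_ltrs] shows. *)
Definition onces ps X :=
  [&& uniq (unzip1 ps), uniq (unzip2 ps) & all (fun ef => once ef.1 ef.2 X) ps].

Lemma onces_cons x ps X : onces (x :: ps) X ->
  [/\ x.1 \notin unzip1 ps, x.2 \notin unzip2 ps, once x.1 x.2 X & onces ps X].
Proof.
by case/and3P => /= /andP [-> h1] /andP [-> h2] /andP [-> h3]; rewrite /onces h1 h2 h3.
Qed.

Lemma once_ltrs e f ps X : e \notin unzip1 ps -> f \notin unzip2 ps ->
  once e f X -> onces ps X -> once e f (ltrs ps X).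
Proof.
elim: ps e f => //= -[e' f'] ps IH e f; rewrite !inE /= !negb_or.
move=> /andP [ne n1] /andP [nf n2] h /onces_cons /= [m1 m2 h' hs].
by apply: once_ltr; rewrite 1?eq_sym //; exact: IH.
Qed.

Lemma perm_onces ps ps' X : perm_eq ps ps' -> onces ps X -> onces ps' X.
Proof.
move=> h /and3P [h1 h2 h3]; apply/and3P; split.
- by rewrite -(perm_uniq (perm_map _ h)).
- by rewrite -(perm_uniq (perm_map _ h)).
- by rewrite -(perm_all _ h).
Qed.

(** All labels of the list being distinct, [ltrC] moves the trace [x] outwards past each of those
    applied after it. *)
Lemma ltrs_rem x ps X : x \in ps -> onces ps X ->
  ltrs ps X = ltr x.1 x.2 (ltrs (rem x ps) X).
Proof.
elim: ps => //= y ps IH; rewrite inE eq_sym; case: (eqVneq y x) => [-> //|ne] /= xps.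
move=> h; have [m1 m2 h' hs] := onces_cons h; rewrite IH //=.
have := perm_onces (perm_to_rem xps) hs => /onces_cons [n1 n2 h'' hs'].
have ne1 : y.1 != x.1 by apply: contraNneq m1 => ->; exact: map_f.
have ne2 : y.2 != x.2 by apply: contraNneq m2 => ->; exact: map_f.
apply: ltrC; rewrite 1?eq_sym //; first exact: once_ltrs.
apply: once_ltrs => //.
  by apply: contra m1 => /mapP [z /mem_rem z1 ->]; exact: map_f.
by apply: contra m2 => /mapP [z /mem_rem z1 ->]; exact: map_f.
Qed.

Lemma ltrs_perm ps ps' X : perm_eq ps ps' -> onces ps X -> ltrs ps X = ltrs ps' X.
Proof.
elim: ps ps' => [|x ps IH] ps' h; first by move: h; rewrite perm_sym => /perm_nilP ->.
move=> hs; have hs' := perm_onces h hs.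
have xps' : x \in ps' by rewrite -(perm_mem h) mem_head.
rewrite (ltrs_rem xps' hs') /= (IH (rem x ps')) //.
  by have := perm_trans h (perm_to_rem xps'); rewrite perm_cons.
by have [] := onces_cons hs.
Qed.

Lemma ltr_ltrs x ps X : onces (x :: ps) X ->
  ltr x.1 x.2 (ltrs ps X) = ltrs ps (ltr x.1 x.2 X).
Proof.
move=> h; rewrite -[LHS]/(ltrs (x :: ps) X) (@ltrs_perm _ (rcons ps x)) //.
  by rewrite /ltrs foldr_rcons.
by rewrite perm_sym perm_rcons.
Qed.

Lemma incount_ltrs ps X y : onces ps X ->
  incount X y = (count_mem y (unzip1 ps) + incount (ltrs ps X) y)%N.
Proof.
elim: ps => //= x ps IH /onces_cons [m1 m2 h hs].
rewrite (IH hs) (incount_ltr _ (once_ltrs m1 m2 h hs)); lia.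
Qed.

Lemma outcount_ltrs ps X y : onces ps X ->
  outcount X y = (count_mem y (unzip2 ps) + outcount (ltrs ps X) y)%N.
Proof.
elim: ps => //= x ps IH /onces_cons [m1 m2 h hs].
rewrite (IH hs) (outcount_ltr _ (once_ltrs m1 m2 h hs)); lia.
Qed.

Lemma ltrs_catl ps X Y : onces ps X ->
  {in ps, forall x, incount Y x.1 = 0%N /\ outcount Y x.2 = 0%N} ->
  ltrs ps (lcat X Y) = lcat (ltrs ps X) Y.
Proof.
elim: ps => //= x ps IH /onces_cons [m1 m2 h hs] hY.
rewrite IH //; last by move=> z zps; apply: hY; rewrite inE zps orbT.
have [] := hY x (mem_head _ _); apply: ltr_catl; exact: once_ltrs.
Qed.

End IteratedTraces.

Lemma ltrs_lmap (T U T' U' : eqType) (f : T -> T') (g : U -> U') ps X :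
  injective f -> injective g -> onces ps X ->
  ltrs [seq (f x.1, g x.2) | x <- ps] (lmap f g X) = lmap f g (ltrs ps X).
Proof.
move=> fi gi; elim: ps => //= x ps IH /onces_cons [m1 m2 h hs].
by rewrite IH // ltr_lmap //; exact: once_ltrs.
Qed.

End Labelled.

(** * The value of a graph *)

Lemma perm_enum_bij (A B : finType) (h : A -> B) :
  bijective h -> perm_eq (enum B) [seq h i | i <- enum A].
Proof.
move=> hb; apply: uniq_perm; first exact: enum_uniq.
  by rewrite (map_inj_uniq (bij_inj hb)) enum_uniq.
case: hb => g gK hK y; rewrite mem_enum inE; apply/esym/mapP; exists (g y) => //.
by rewrite mem_enum.
Qed.

Lemma enum_sum (A B : finType) :
  enum {: A + B} = [seq inl i | i <- enum A] ++ [seq inr i | i <- enum B].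
Proof. by rewrite !enumT [in LHS]unlock. Qed.

Lemma sum_enum_eq (A : finType) (T : eqType) (a : A -> T) y (Q : pred A) :
  count_mem y [seq a i | i <- enum A & Q i] = (\sum_(i | Q i) (a i == y))%N.
Proof.
rewrite count_map -sum1_count big_filter_cond big_enum_cond big_mkcond [RHS]big_mkcond.
by apply: eq_bigr => i _ /=; case: (Q i); case: (a i == y).
Qed.

Lemma filter_enum_inl (A A2 V V2 : finType) (T : Type) (t : A -> V) (t2 : A2 -> V2)
    (a : A + A2 -> T) v :
  [seq a i | i <- enum {: A + A2} & sum_map t t2 i == inl v]
  = [seq a (inl i) | i <- enum A & t i == v].
Proof.
rewrite enum_sum filter_cat !filter_map -[RHS]cats0 map_cat; congr cat.
  by rewrite -map_comp.
by rewrite (eq_filter (a2 := pred0)) // filter_pred0.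
Qed.

Lemma filter_enum_inr (A A2 V V2 : finType) (T : Type) (t : A -> V) (t2 : A2 -> V2)
    (a : A + A2 -> T) v :
  [seq a i | i <- enum {: A + A2} & sum_map t t2 i == inr v]
  = [seq a (inr i) | i <- enum A2 & t2 i == v].
Proof.
rewrite enum_sum filter_cat !filter_map map_cat -[RHS]cat0s; congr cat.
  by rewrite (eq_filter (a2 := pred0)) // filter_pred0.
by rewrite -map_comp.
Qed.

(** * Pieces of a cut graph and the value of a graph *)

Section Corollas.
Variables (K : fieldType) (P : trap K) (x : forall k l : nat, P k l).
Hypothesis hx : forall (k l : nat) (s : 'S_l) (t : 'S_k),
  actr (actl s (x k l)) t = x k l.

Definition lcor (T U : eqType) (s : seq T) (s' : seq U) : lab P T U :=
  mk (x (size s) (size s')) (tnth (in_tuple s)) (tnth (in_tuple s')).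

(** The invariance of [x k l] enters here: it absorbs the permutations between two orderings of the
    labels, so a labelled corolla depends only on two multisets. *)
Lemma mk_lcor (T U : eqType) k l (a : 'I_k -> T) (b : 'I_l -> U) s s' :
  perm_eq [seq a i | i <- enum 'I_k] s -> perm_eq [seq b i | i <- enum 'I_l] s' ->
  mk (x k l) a b = lcor s s'.
Proof.
move=> ha hb; rewrite /lcor.
have [|ek [t et]] := @eq_count_perm _ k (size s) a (tnth (in_tuple s)).
  by move=> y; rewrite !sum_eq_count (seq.permP ha) (map_tnth_enum (in_tuple s)).
have [|el [u eu]] := @eq_count_perm _ l (size s') b (tnth (in_tuple s')).
  by move=> y; rewrite !sum_eq_count (seq.permP hb) (map_tnth_enum (in_tuple s')).
subst k l; rewrite et eu -[X in mk X _ _ = _](hx (u^-1)%g t).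
rewrite (actlr (trap_axioms P)) mk_act; congr mk; apply/funext => i /=.
  by rewrite permKV; congr tnth; apply: val_inj.
by rewrite permKV; congr tnth; apply: val_inj.
Qed.

Lemma eq_lcor (T U : eqType) (s1 s2 : seq T) (s1' s2' : seq U) :
  perm_eq s1 s2 -> perm_eq s1' s2' -> lcor s1 s1' = lcor s2 s2'.
Proof.
move=> h h'; apply: mk_lcor.
  by rewrite (map_tnth_enum (in_tuple s1)).
by rewrite (map_tnth_enum (in_tuple s1')).
Qed.

Lemma lmap_lcor (T U T' U' : eqType) (f : T -> T') (g : U -> U') s s' :
  lmap f g (lcor s s') = lcor (map f s) (map g s').
Proof.
rewrite lmap_mk; apply: mk_lcor.
  by rewrite (map_comp f) (map_tnth_enum (in_tuple s)).
by rewrite (map_comp g) (map_tnth_enum (in_tuple s')).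
Qed.

Lemma incount_lcor (T U : eqType) (s : seq T) (s' : seq U) y :
  incount (lcor s s') y = count_mem y s.
Proof. by rewrite incount_mk sum_eq_count (map_tnth_enum (in_tuple s)). Qed.

Lemma outcount_lcor (T U : eqType) (s : seq T) (s' : seq U) y :
  outcount (lcor s s') y = count_mem y s'.
Proof. by rewrite outcount_mk sum_eq_count (map_tnth_enum (in_tuple s')). Qed.

Local Notation "\lcat_ ( i : t ) F" :=
  (\big[@lcat _ _ _ _/@lone _ _ _ _]_(i : t) F)
  (at level 41, i, t at level 50, F at level 41).

Section Pieces.
Variables T U : eqType.

(** The horizontal concatenation of one corolla per vertex, one wire per
    input-output edge and the loops, before any gluing.  The half-edges
    ending (starting) at vertices are [A] and [B]. *)
Definition pieces (V A B W L : finType) (t : A -> V) (s : B -> V)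
    (a : A -> T) (b : B -> U) (a' : W -> T) (b' : W -> U) : lab P T U :=
  lcat (lcat
    (\lcat_(v : V) lcor [seq a i | i <- enum A & t i == v]
                        [seq b j | j <- enum B & s j == v])
    (\lcat_(w : W) lwire P (a' w) (b' w)))
    (\lcat_(z : L) lloop P T U).

Lemma incount_pieces (V A B W L : finType) (t : A -> V) (s : B -> V) a b
    (a' : W -> T) b' y :
  incount (pieces L t s a b a' b') y
  = (\sum_i (a i == y) + \sum_w (a' w == y))%N.
Proof.
rewrite !incount_lcat !incount_big [X in (_ + X)%N]big1 ?addn0 => [|z _]; last first.
  exact: incount_lloop.
congr addn; last by apply: eq_bigr => w _; rewrite incount_lwire.
rewrite (partition_big t xpredT) //=; apply: eq_bigr => v _.
by rewrite incount_lcor sum_enum_eq.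
Qed.

Lemma outcount_pieces (V A B W L : finType) (t : A -> V) (s : B -> V) a b
    (a' : W -> T) b' y :
  outcount (pieces L t s a b a' b') y
  = (\sum_i (b i == y) + \sum_w (b' w == y))%N.
Proof.
rewrite !outcount_lcat !outcount_big [X in (_ + X)%N]big1 ?addn0 => [|z _]; last first.
  exact: outcount_lloop.
congr addn; last by apply: eq_bigr => w _; rewrite outcount_lwire.
rewrite (partition_big s xpredT) //=; apply: eq_bigr => v _.
by rewrite outcount_lcor sum_enum_eq.
Qed.

Lemma pieces_bij (V A B W L V2 A2 B2 W2 L2 : finType)
    (hV : V -> V2) (hA : A -> A2) (hB : B -> B2) (hW : W -> W2) (hL : L -> L2)
    (t : A -> V) (s : B -> V) a b a' b' (t2 : A2 -> V2) (s2 : B2 -> V2)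
    (a2 : A2 -> T) (b2 : B2 -> U) (a2' : W2 -> T) (b2' : W2 -> U) :
  bijective hV -> bijective hA -> bijective hB -> bijective hW -> bijective hL ->
  (forall i, t2 (hA i) = hV (t i)) -> (forall j, s2 (hB j) = hV (s j)) ->
  (forall i, a2 (hA i) = a i) -> (forall j, b2 (hB j) = b j) ->
  (forall w, a2' (hW w) = a' w) -> (forall w, b2' (hW w) = b' w) ->
  pieces L2 t2 s2 a2 b2 a2' b2' = pieces L t s a b a' b'.
Proof.
move=> bV bA bB bW bL et es ea eb ea' eb'; rewrite /pieces.
rewrite (bigop.reindex hV) /=; last exact: onW_bij.
rewrite (bigop.reindex hW) /=; last exact: onW_bij.
rewrite (bigop.reindex hL) /=; last exact: onW_bij.
congr lcat; congr lcat; last by apply: eq_bigr => w _; rewrite ea' eb'.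
apply: eq_bigr => v _; apply: eq_lcor.
  apply: perm_trans (perm_map _ (perm_filter _ (perm_enum_bij bA))) _.
  rewrite filter_map -map_comp (eq_map (g := a)) // (eq_filter
    (a2 := fun i => t i == v)) //.
  by move=> i /=; rewrite et (inj_eq (bij_inj bV)).
apply: perm_trans (perm_map _ (perm_filter _ (perm_enum_bij bB))) _.
rewrite filter_map -map_comp (eq_map (g := b)) // (eq_filter
  (a2 := fun i => s i == v)) //.
by move=> i /=; rewrite es (inj_eq (bij_inj bV)).
Qed.

(** Isolating one wire prepares its trace against the remaining pieces, or against itself. *)
Lemma pieces_wire (V A B W L : finType) (w0 : W) (t : A -> V) (s : B -> V) a b
    (a' : W -> T) (b' : W -> U) :
  pieces L t s a b a' b' = lcat (lwire P (a' w0) (b' w0))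
    (pieces (W := {w : W | w != w0}) L t s a b (a' \o val) (b' \o val)).
Proof.
rewrite /pieces (bigD1 w0) //= (eq_bigl [in predC1 w0]) // (big_sub (predC1 w0)).
by rewrite lcatA (lcatC _ (lwire _ _ _)) -!lcatA.
Qed.

Lemma pieces_sum (V A B W L V2 A2 B2 W2 L2 : finType)
    (t : A -> V) (s : B -> V) (t2 : A2 -> V2) (s2 : B2 -> V2)
    (a : A + A2 -> T) (b : B + B2 -> U) (a' : W + W2 -> T) (b' : W + W2 -> U) :
  pieces (L + L2)%type (sum_map t t2) (sum_map s s2) a b a' b'
  = lcat (pieces L t s (a \o inl) (b \o inl) (a' \o inl) (b' \o inl))
         (pieces L2 t2 s2 (a \o inr) (b \o inr) (a' \o inr) (b' \o inr)).
Proof.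
rewrite /pieces !big_sumType /=.
have e1 X Y Z X' Y' Z' : lcat (lcat (lcat X X') (lcat Y Y')) (lcat Z Z')
    = lcat (lcat (lcat X Y) Z) (lcat (lcat X' Y') Z') :> lab P T U.
  by rewrite [LHS](AC (2*2*2) (1*3*5*(2*4*6)))%AC.
rewrite -e1; congr lcat; congr lcat; congr lcat; apply: eq_bigr => v _.
  by rewrite !filter_enum_inl.
by rewrite !filter_enum_inr.
Qed.

End Pieces.

Lemma lmap_pieces (T U T' U' : eqType) (f : T -> T') (g : U -> U')
    (V A B W L : finType) (t : A -> V) (s : B -> V) a b (a' : W -> T) b' :
  lmap f g (pieces L t s a b a' b')
  = pieces L t s (f \o a) (g \o b) (f \o a') (g \o b').
Proof.
rewrite /pieces !lmap_lcat !lmap_big; congr (lcat (lcat _ _) _); apply: eq_bigr => z _.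
- by rewrite lmap_lcor -!map_comp.
- exact: lmap_lwire.
- exact: lmap_lloop.
Qed.

Definition gpairs (T U : eqType) (E : finType) (ea : E -> T) (eb : E -> U) :=
  [seq (ea e, eb e) | e <- enum E].

Section GraphPieces.
Variables (T U : eqType) (k l : nat) (G : graph k l).
Variables (ea : gE G -> T) (ca : 'I_k -> T) (eb : gE G -> U) (cb : 'I_l -> U).

Definition hin (i : gE G + gI G) : T :=
  match i with inl e => ea e | inr i => ca (galpha (inl i)) end.

Definition hout (j : gE G + gO G) : U :=
  match j with inl e => eb e | inr j => cb (gbeta (inl j)) end.

(** The internal edge [e] is cut into an input labelled [ea e] and an output
    labelled [eb e], the inputs and outputs are labelled by [ca] and [cb]. *)
Definition gpieces : lab P T U :=
  pieces (gL G) (@gtgt _ _ G) (@gsrc _ _ G) hin hout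
    (fun w : gIO G => ca (galpha (inr w))) (fun w : gIO G => cb (gbeta (inr w))).

(** Joins the labels of the cut edges and of the external indices, so that a single injectivity
    hypothesis makes all of them distinct. *)
Definition sumf (A B C : Type) (f : A -> C) (g : B -> C) (z : A + B) : C :=
  match z with inl x => f x | inr y => g y end.

Lemma incount_gpieces y :
  incount gpieces y = (\sum_e (ea e == y) + \sum_i (ca i == y))%N.
Proof.
rewrite incount_pieces big_sumType /= -addnA; congr addn.
rewrite [RHS](bigop.reindex (@galpha _ _ G)); last exact: onW_bij (galpha_bij G).
by rewrite big_sumType.
Qed.

Lemma outcount_gpieces y :
  outcount gpieces y = (\sum_e (eb e == y) + \sum_i (cb i == y))%N.
Proof.
rewrite outcount_pieces big_sumType /= -addnA; congr addn.
rewrite [RHS](bigop.reindex (@gbeta _ _ G)); last exact: onW_bij (gbeta_bij G).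
by rewrite big_sumType.
Qed.

Hypotheses (ia : injective (sumf ea ca)) (ib : injective (sumf eb cb)).

Lemma incount_gpieces1 z : incount gpieces (sumf ea ca z) = 1%N.
Proof. by rewrite incount_gpieces -(sum_inj1 z ia) big_sumType. Qed.

Lemma outcount_gpieces1 z : outcount gpieces (sumf eb cb z) = 1%N.
Proof. by rewrite outcount_gpieces -(sum_inj1 z ib) big_sumType. Qed.

Lemma once_gpieces z z' : once (sumf ea ca z) (sumf eb cb z') gpieces.
Proof. by rewrite /once incount_gpieces1 outcount_gpieces1. Qed.

Lemma onces_gpairs : onces (gpairs ea eb) gpieces.
Proof.
apply/and3P; split.
- rewrite /unzip1 -map_comp map_inj_uniq ?enum_uniq // => e e' h.
  by have [] := ia (h : sumf ea ca (inl e) = sumf ea ca (inl e')).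
- rewrite /unzip2 -map_comp map_inj_uniq ?enum_uniq // => e e' h.
  by have [] := ib (h : sumf eb cb (inl e) = sumf eb cb (inl e')).
- by apply/allP => _ /mapP [e _ ->]; exact: (once_gpieces (inl e) (inl e)).
Qed.

(** By counting: the labels of the pieces are those of the cut edges and the external ones, and the
    traces consume exactly the former. Then [mk_normal] applies. *)
Lemma ltrs_gpieces : exists q, ltrs (gpairs ea eb) gpieces = mk q ca cb.
Proof.
have sum_enum (A : eqType) (h : gE G -> A) y :
    count_mem y [seq h e | e <- enum (gE G)] = (\sum_e (h e == y))%N.
  by rewrite -[enum _]filter_predT sum_enum_eq.
apply: mk_normal => y.
  apply: (@addnI (\sum_e (ea e == y))); rewrite -incount_gpieces.
  by rewrite (incount_ltrs _ onces_gpairs) /unzip1 -map_comp sum_enum.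
apply: (@addnI (\sum_e (eb e == y))); rewrite -outcount_gpieces.
by rewrite (outcount_ltrs _ onces_gpairs) /unzip2 -map_comp sum_enum.
Qed.

End GraphPieces.

Lemma inlr_inj (A B : Type) : injective (@sumf A B (A + B) inl inr).
Proof. by case=> ? [] ? //= -[->]. Qed.

(** Computed with tautological labels, each internal edge and each index being its own label. *)
Definition Phi k l (G : graph k l) : P k l :=
  projT1 (cid (ltrs_gpieces (@inlr_inj (gE G) 'I_k) (@inlr_inj (gE G) 'I_l))).

(** Any injective labelling is the image of the tautological one under [sumf ea ca] and
    [sumf eb cb], and traces commute with injective relabellings. *)
Lemma PhiE (T U : eqType) k l (G : graph k l) (ea : gE G -> T) (ca : 'I_k -> T)
    (eb : gE G -> U) (cb : 'I_l -> U) :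
  injective (sumf ea ca) -> injective (sumf eb cb) ->
  ltrs (gpairs ea eb) (gpieces ea ca eb cb) = mk (Phi G) ca cb.
Proof.
move=> ia ib; rewrite /Phi; case: cid => q /= hq.
have := congr1 (lmap (sumf ea ca) (sumf eb cb)) hq.
rewrite -ltrs_lmap //; last exact: onces_gpairs (@inlr_inj _ _) (@inlr_inj _ _).
rewrite lmap_mk /= lmap_pieces /gpairs -map_comp => <-.
congr ltrs; congr pieces; apply/funext; by case.
Qed.

Lemma Phi_uniq (T U : eqType) k l (G : graph k l) (ea : gE G -> T) (ca : 'I_k -> T)
    (eb : gE G -> U) (cb : 'I_l -> U) q :
  injective (sumf ea ca) -> injective (sumf eb cb) ->
  ltrs (gpairs ea eb) (gpieces ea ca eb cb) = mk q ca cb -> Phi G = q.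
Proof.
move=> ia ib; rewrite PhiE //; apply: mk_inj.
  by move=> i i' h; have [] := ia (inr i) (inr i') h.
by move=> i i' h; have [] := ib (inr i) (inr i') h.
Qed.

Lemma gpairs_bij (T U : eqType) (E E' : finType) (h : E -> E') (ea : E' -> T)
    (eb : E' -> U) :
  bijective h -> perm_eq (gpairs (ea \o h) (eb \o h)) (gpairs ea eb).
Proof.
move=> hb; rewrite perm_sym; apply: perm_trans (perm_map _ (perm_enum_bij hb)) _.
by rewrite -map_comp.
Qed.

Lemma Phi_iso k l (G H : graph k l) : graph_iso G H -> Phi G = Phi H.
Proof.
case=> fV [fE [fI [fO [fIO [fL [bV bE bI bO bIO bL hs ht ha hb]]]]]].
have inj_lab (n : nat) : injective (sumf (@inl (gE H) 'I_n \o fE) inr).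
  by move=> [e|i] [e'|i'] //= -[]; [move/(bij_inj bE) => -> | move=> ->].
apply: (Phi_uniq (inj_lab k) (inj_lab l)).
rewrite -(PhiE (@inlr_inj _ _) (@inlr_inj _ _)).
rewrite (ltrs_perm (gpairs_bij _ _ bE)) //;
  last exact: onces_gpairs (inj_lab k) (inj_lab l).
congr ltrs; apply/esym/(@pieces_bij _ _ _ _ _ _ _ _ _ _ _ _ fV (sum_map fE fI)
  (sum_map fE fO) fIO fL) => //;
  try exact: sum_map_bij.
- by case=> i //=; rewrite -(ha (inl i)).
- by case=> i //=; rewrite -(hb (inl i)).
- by move=> w; rewrite -(ha (inr w)).
- by move=> w; rewrite -(hb (inr w)).
Qed.

(** The pieces of [graph_actl G s] with tautological labels are those of [G] with output labels
    [inr \o s]: the action is a mere relabelling. *)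
Lemma Phi_actl k l (G : graph k l) s : Phi (graph_actl G s) = actl s (Phi G).
Proof.
apply: (Phi_uniq (@inlr_inj _ _) (@inlr_inj _ _)); rewrite mk_actl.
have i2 : injective (sumf (@inl (gE G) 'I_l) (inr \o s)).
  by move=> [e|i] [e'|i'] //= -[] /perm_inj ->.
exact: PhiE (@inlr_inj _ _) i2.
Qed.

Lemma Phi_actr k l (G : graph k l) t : Phi (graph_actr G t) = actr (Phi G) t.
Proof.
apply: (Phi_uniq (@inlr_inj _ _) (@inlr_inj _ _)); rewrite mk_actr.
have i1 : injective (sumf (@inl (gE G) 'I_k) (inr \o (t^-1)%g)).
  by move=> [e|i] [e'|i'] //= -[] /perm_inj ->.
exact: PhiE i1 (@inlr_inj _ _).
Qed.

Lemma gpairs_sum (T U : eqType) (E E' : finType) (ea : E + E' -> T) (eb : E + E' -> U) :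
  gpairs ea eb = gpairs (ea \o inl) (eb \o inl) ++ gpairs (ea \o inr) (eb \o inr).
Proof. by rewrite /gpairs enum_sum map_cat -!map_comp. Qed.

Lemma inlr_inl_inj (A A' B B' : Type) (h : B' -> B) : injective h ->
  injective (sumf (@inl (A + A') B \o inl) (inr \o h)).
Proof. by move=> hi [a|b] [a'|b'] //= -[] => [->|/hi ->]. Qed.

Lemma inlr_inr_inj (A A' B B' : Type) (h : B' -> B) : injective h ->
  injective (sumf (@inl (A + A') B \o inr) (inr \o h)).
Proof. by move=> hi [a|b] [a'|b'] //= -[] => [->|/hi ->]. Qed.

Lemma Phi_cat k l k' l' (G : graph k l) (H : graph k' l') :
  Phi (graph_cat G H) = hcat (Phi G) (Phi H).
Proof.
apply: (Phi_uniq (@inlr_inj _ _) (@inlr_inj _ _)).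
pose XG := gpieces (G := G) (@inl (gE G + gE H) 'I_(k + k') \o inl) (inr \o lshift k')
  (@inl (gE G + gE H) 'I_(l + l') \o inl) (inr \o lshift l').
pose XH := gpieces (G := H) (@inl (gE G + gE H) 'I_(k + k') \o inr)
  (inr \o @rshift k k')
  (@inl (gE G + gE H) 'I_(l + l') \o inr) (inr \o @rshift l l').
have -> : gpieces (G := graph_cat G H) (@inl (gE (graph_cat G H)) 'I_(k + k')) inr
    (@inl (gE (graph_cat G H)) 'I_(l + l')) inr = lcat XG XH.
  set a := hin (G := G) (@inl (gE G + gE H) 'I_(k + k') \o inl) (inr \o lshift k').
  set a2 := hin (G := H) (@inl (gE G + gE H) 'I_(k + k') \o inr) (inr \o @rshift k k').
  set b := hout (G := G) (@inl (gE G + gE H) 'I_(l + l') \o inl) (inr \o lshift l').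
  set b2 := hout (G := H) (@inl (gE G + gE H) 'I_(l + l') \o inr) (inr \o @rshift l l').
  rewrite -[RHS](@pieces_sum _ _ _ _ _ _ _ _ _ _ _ _ _ _ _ _ (sumf a a2) (sumf b b2)
    (sumf (fun w : gIO G => inr (lshift k' (galpha (inr w))))
          (fun w : gIO H => inr (rshift k (galpha (inr w)))))
    (sumf (fun w : gIO G => inr (lshift l' (gbeta (inr w))))
          (fun w : gIO H => inr (rshift l (gbeta (inr w)))))).
  (* In [graph_cat] the half-edges are grouped by kind, in [pieces_sum] by factor; [sum_shuffle]
     passes from one to the other. *)
  apply/esym/(@pieces_bij _ _ _ _ _ _ _ _ _ _ _ _ id (@sum_shuffle _ _ _ _)
    (@sum_shuffle _ _ _ _) id id) => //; try exact: sum_shuffle_bij;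
    try (by exists id); (try by case=> -[]); by case.
rewrite gpairs_sum /ltrs foldr_cat -!/(ltrs _ _).
have iG n n' := inlr_inl_inj (A := gE G) (A' := gE H) (@lshift_inj n n').
have iH n n' := inlr_inr_inj (A := gE G) (A' := gE H) (@rshift_inj n n').
have hG := PhiE (iG k k') (iG l l').
have hH := PhiE (iH k k') (iH l l').
(* The traces of [H] are innermost and their labels do not occur in [XG]; the exchange puts [XH] on
   the left, where [ltrs_catl] acts. The traces of [G] are then treated in the same way. *)
rewrite (lcatC XG) ltrs_catl; last 2 first.
- exact: onces_gpairs (iH k k') (iH l l').
- move=> _ /mapP [e _ ->]; rewrite incount_gpieces outcount_gpieces !big1 //.
rewrite hH lcatC ltrs_catl; last 2 first.
- exact: onces_gpairs (iG k k') (iG l l').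
- by move=> _ /mapP [e _ ->]; rewrite incount_mk outcount_mk !big1.
rewrite hG lcat_mk; congr mk; exact/esym/cat_funP.
Qed.

Lemma enum_void : enum (void : finType) = [::].
Proof. by apply: size0nil; rewrite -cardE card_void. Qed.

Lemma big_void (T U : eqType) (F : void -> lab P T U) :
  \lcat_(v : void) F v = @lone _ P T U.
Proof. by rewrite big1 // => -[]. Qed.

Lemma big_unit1 (T U : eqType) (F : unit -> lab P T U) :
  \lcat_(v : unit) F v = F tt.
Proof. by rewrite (big_pred1 tt) //; case. Qed.

Lemma lcat0 (T U : eqType) (X : lab P T U) : lcat X (@lone _ P T U) = X.
Proof. by rewrite lcatC lcat1. Qed.

Lemma Phi_empty : Phi empty_graph = hunit P.
Proof.
apply: (Phi_uniq (@inlr_inj _ _) (@inlr_inj _ _)).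
rewrite /gpairs enum_void /= /gpieces /pieces !big_void !lcat0 /lone.
by congr mk; exact/esym/eq_no_fun.
Qed.

Lemma Phi_wire : Phi wire_graph = wire P.
Proof.
apply: (Phi_uniq (@inlr_inj _ _) (@inlr_inj _ _)).
rewrite /gpairs enum_void /= /gpieces /pieces !big_void big_unit1 lcat0 lcat1.
by congr mk; apply/funext => i; rewrite (ord1 i).
Qed.

Lemma Phi_corolla k l : Phi (corolla k l) = x k l.
Proof.
apply: (Phi_uniq (@inlr_inj _ _) (@inlr_inj _ _)).
rewrite /gpairs enum_void /= /gpieces /pieces !big_void big_unit1 !lcat0.
apply/esym/mk_lcor; rewrite (eq_filter (a2 := xpredT)) // filter_predT.
  by rewrite enum_sum enum_void /= -map_comp.
by rewrite enum_sum enum_void /= -map_comp.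
Qed.

Lemma pieces_loop (T U : eqType) (V A B W L : finType) (t : A -> V) (s : B -> V) a b
    (a' : W -> T) (b' : W -> U) :
  pieces (option L) t s a b a' b' = lcat (lloop P T U) (pieces L t s a b a' b').
Proof.
rewrite /pieces (bigop.reindex (sumf (fun _ : unit => @None L) Some)) /=.
  by rewrite big_sumType big_unit1 /= lcatA (lcatC _ (lloop _ _ _)) -!lcatA.
apply: onW_bij; exists (fun o => if o is Some z then inr z else inl tt); last by case.
by case=> [[]|].
Qed.

(** * Compatibility with the gluing of graphs *)

Section Glue.
Variables (k l : nat) (G : graph k.+1 l.+1).
Local Notation E := (gE G).
Local Notation X := (gpieces (@inl E 'I_k.+1) inr (@inl E 'I_l.+1) inr).
Local Notation ps := (gpairs (@inl E 'I_k.+1) (@inl E 'I_l.+1)).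

Lemma ltr_Phi i j : ltr (inr i) (inr j) (ltrs ps X)
  = mk (ptr i j (Phi G)) (inr \o lift i) (inr \o lift j).
Proof.
rewrite PhiE; try exact: inlr_inj.
apply: (ltr_mk (a := inr) (b := inr) (i := i) (j := j)).
have inr_i A B : injective (@inr A B) by move=> ? ? [].
by rewrite /once incount_mk outcount_mk !sum_inj1 //; exact: inr_i.
Qed.

(** External edges of a glued graph are labelled by indices of [G], with [i] missing, so that the
    renumbering never shows. *)
Lemma lift_lab_inj n (i : 'I_n.+1) :
  injective (sumf (@inl E 'I_n.+1) (inr \o lift i : 'I_n -> _)).
Proof.
move=> [e|y] [e'|y'] //= [] h; first by rewrite h.
by congr inr; apply: (@lift_inj _ i); exact: val_inj.
Qed.

Lemma reindexE n (A A' : finType) (f : A -> 'I_n.+1) (fb : bijective f) a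
  (iota : A' -> A)
    (iota_neq : forall y, iota y != a) y :
  lift (f a) (Defs.reindex fb iota_neq y) = f (iota y).
Proof. exact: lift_shrink. Qed.

(** Gluing two half-edges leaves the half-edges at the vertices unchanged: once cut, the new edge
    [None] gives back [c]. *)
Lemma glue_half_bij (A : finType) (c : A) : 
  bijective (fun z : option E + {y : A | y != c} => match z with
    | inl (Some e) => inl e | inl None => inr c | inr y => inr (val y) end).
Proof.
apply: fin_bij => [|[e|y]].
- move=> [[e|]|[y ny]] [[e'|]|[y' ny']] //=.
  + by case=> ->.
  + by case=> e0; exfalso; move: ny'; rewrite -e0 eqxx.
  + by case=> e0; exfalso; move: ny; rewrite e0 eqxx.
  + by case=> e0; congr inr; apply: val_inj.
- by exists (inl (Some e)).
- case: (eqVneq y c) => [->|ne]; first by exists (inl None).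
  by exists (inr (Sub y ne)).
Qed.

Lemma enum_option (A : finType) : enum
  (option A : finType) = None :: [seq Some i | i <- enum A].
Proof. by rewrite !enumT [in LHS]unlock. Qed.

(** The new edge is labelled by the two indices that disappear, which [lift] avoids. The pieces are
    then those of [G]; since [None] comes first in the enumeration, the additional trace is
    outermost, as in [ltr_Phi]. *)
Lemma Phi_glue_I_O (e : gI G) (f : gO G) :
  Phi (glue_I_O e f) = ptr (galpha (inl e)) (gbeta (inl f)) (Phi G).
Proof.
set i := galpha _; set j := gbeta _.
pose ea n (i : 'I_n.+1) (o : option E) : E + 'I_n.+1 := if o is Some y then inl y
  else inr i.
have ea_inj n (i' : 'I_n.+1) : injective (sumf (ea n i') (inr \o lift i')).
  move=> [[y|]|y] [[y'|]|y'] //= [].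
  - by move=> ->.
  - by move/eqP; rewrite (negPf (neq_lift _ _)).
  - by move/esym/eqP; rewrite (negPf (neq_lift _ _)).
  - by move/(@val_inj _ _ _ (lift i' y) (lift i' y'))/lift_inj => ->.
apply: (Phi_uniq (G := glue_I_O e f) (ea_inj k i) (ea_inj l j)).
rewrite -ltr_Phi /gpairs [enum _]enum_option /= -map_comp; congr (ltr _ _ (ltrs _ _)).
apply/esym/(@pieces_bij _ _ _ _ _ _ _ _ _ _ _ _ id _ _ id id) => //; try by exists id.
- exact: glue_half_bij e.
- exact: glue_half_bij f.
- by case=> -[].
- by case=> -[].
- by case=> [[]|y] //=; rewrite reindexE.
- by case=> [[]|y] //=; rewrite reindexE.
- by move=> w /=; rewrite reindexE.
- by move=> w /=; rewrite reindexE.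
Qed.

(** When a wire is glued the new trace has to act directly on the pieces, so it is moved
    innermost. *)
Lemma ltrs_ltr i j : ltrs ps (ltr (inr i) (inr j) X)
  = mk (ptr i j (Phi G)) (inr \o lift i) (inr \o lift j).
Proof.
rewrite -ltr_Phi; apply/esym/(ltr_ltrs (x := (inr i, inr j))).
have i1 := @inlr_inj E 'I_k.+1; have i2 := @inlr_inj E 'I_l.+1.
have /and3P [h1 h2 h3] := onces_gpairs i1 i2.
apply/and3P; split; rewrite /= ?h1 ?h2 ?h3 ?andbT.
- by rewrite /unzip1 -map_comp; apply/mapP => -[].
- by rewrite /unzip2 -map_comp; apply/mapP => -[].
- exact: once_gpieces i1 i2 (inr i) (inr j).
Qed.

Definition gpieces_but (w0 : gIO G) : lab P (E + 'I_k.+1)%type (E + 'I_l.+1)%type :=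
  pieces (W := {w : gIO G | w != w0}) (gL G) (@gtgt _ _ G) (@gsrc _ _ G)
    (hin inl inr) (hout inl inr)
    (fun w => inr (galpha (inr (val w)))) (fun w => inr (gbeta (inr (val w)))).

Lemma gpieces_wire w0 :
  X = lcat (lwire P (inr (galpha (inr w0))) (inr (gbeta (inr w0)))) (gpieces_but w0).
Proof. exact: pieces_wire. Qed.

Lemma incount_but w0 z :
  incount (gpieces_but w0) z = (z != inr (galpha (inr w0))) :> nat.
Proof.
have := incount_gpieces1 (@inl E 'I_l.+1) inr (@inlr_inj E 'I_k.+1) z;
  rewrite (gpieces_wire w0).
rewrite incount_lcat incount_lwire (_ : sumf inl inr z = z); last by case: z.
by rewrite eq_sym; case: (z == _); rewrite ?add1n ?add0n => -[->].
Qed.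

Lemma outcount_but w0 z :
  outcount (gpieces_but w0) z = (z != inr (gbeta (inr w0))) :> nat.
Proof.
have := outcount_gpieces1 (@inl E 'I_k.+1) inr (@inlr_inj E 'I_l.+1) z;
  rewrite (gpieces_wire w0).
rewrite outcount_lcat outcount_lwire (_ : sumf inl inr z = z); last by case: z.
by rewrite eq_sym; case: (z == _); rewrite ?add1n ?add0n => -[->].
Qed.

Lemma inr_galpha_eq (y y' : gI G + gIO G) :
  (inr (galpha y) == inr (galpha y') :> E + 'I_k.+1) = (y == y').
Proof. by apply/eqP/eqP => [[] /(bij_inj (galpha_bij G))|->]. Qed.

Lemma inr_gbeta_eq (y y' : gO G + gIO G) :
  (inr (gbeta y) == inr (gbeta y') :> E + 'I_l.+1) = (y == y').
Proof. by apply/eqP/eqP => [[] /(bij_inj (gbeta_bij G))|->]. Qed.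

(** Tracing the wire of [e] against [f] gives [f] the output label of [e], which is the effect of
    [incl_takel]. *)
Lemma Phi_glue_IO_O (e : gIO G) (f : gO G) :
  Phi (glue_IO_O e f) = ptr (galpha (inr e)) (gbeta (inl f)) (Phi G).
Proof.
apply: (Phi_uniq (G := glue_IO_O e f) (@lift_lab_inj _ (galpha (inr e)))
  (@lift_lab_inj _ (gbeta (inl f)))).
rewrite -ltrs_ltr; congr ltrs; rewrite (gpieces_wire e) ltr_wirel; last 3 first.
- by rewrite inr_gbeta_eq.
- by rewrite incount_but eqxx.
- by rewrite outcount_but inr_gbeta_eq.
rewrite /gpieces_but lmap_pieces; congr pieces; apply/funext.
- by case=> [//|y] /=; rewrite reindexE.
- case=> [//|y] /=; rewrite reindexE /relabel inr_gbeta_eq /=.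
  by case: eqP => [->|h]; [rewrite eqxx | case: eqP => // -[]].
- by move=> w /=; rewrite reindexE.
- by move=> w /=; rewrite reindexE /relabel inr_gbeta_eq.
Qed.

Lemma Phi_glue_I_IO (e : gI G) (f : gIO G) :
  Phi (glue_I_IO e f) = ptr (galpha (inl e)) (gbeta (inr f)) (Phi G).
Proof.
apply: (Phi_uniq (G := glue_I_IO e f) (@lift_lab_inj _ (galpha (inl e)))
  (@lift_lab_inj _ (gbeta (inr f)))).
rewrite -ltrs_ltr; congr ltrs; rewrite (gpieces_wire f) ltr_wirer; last 3 first.
- by rewrite inr_galpha_eq.
- by rewrite incount_but inr_galpha_eq.
- by rewrite outcount_but eqxx.
rewrite /gpieces_but lmap_pieces; congr pieces; apply/funext.
- case=> [//|y] /=; rewrite reindexE /relabel inr_galpha_eq /=.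
  by case: eqP => [->|h]; [rewrite eqxx | case: eqP => // -[]].
- by case=> [//|y] /=; rewrite reindexE.
- by move=> w /=; rewrite reindexE /relabel inr_galpha_eq.
- by move=> w /=; rewrite reindexE.
Qed.

(** If [e = f], the wire is traced against itself and becomes the additional loop; otherwise the
    wire of [e] relabels the output end of the wire of [f], as [incl_taker] does. *)
Lemma Phi_glue_IO_IO (e f : gIO G) :
  Phi (glue_IO_IO e f) = ptr (galpha (inr e)) (gbeta (inr f)) (Phi G).
Proof.
apply: (Phi_uniq (G := glue_IO_IO e f) (@lift_lab_inj _ (galpha (inr e)))
  (@lift_lab_inj _ (gbeta (inr f)))).
rewrite -ltrs_ltr; congr ltrs; rewrite (gpieces_wire e).
have [ef|ne] := eqVneq e f.
  subst f; rewrite ltr_catl; last 3 first.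
  - by rewrite /once incount_lwire outcount_lwire !eqxx.
  - by rewrite incount_but eqxx.
  - by rewrite outcount_but eqxx.
  rewrite ltr_wire /gpieces_but /gpieces /= eqxx pieces_loop.
  congr lcat; congr pieces; apply/funext.
  - by case=> [//|y] /=; rewrite reindexE.
  - by case=> [//|y] /=; rewrite reindexE.
  - by move=> w /=; rewrite reindexE.
  - by case=> [w ne] /=; rewrite reindexE /= (negPf ne).
rewrite ltr_wirel; last 3 first.
- by rewrite inr_gbeta_eq; apply: contra ne => /eqP [->].
- by rewrite incount_but eqxx.
- by rewrite outcount_but inr_gbeta_eq eq_sym; apply/eqP; rewrite eqb1;
  apply: contra ne => /eqP [->].
rewrite /gpieces_but lmap_pieces /gpieces /= (negPf ne); congr pieces; apply/funext.
- by case=> [//|y] /=; rewrite reindexE.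
- by case=> [//|y] /=; rewrite reindexE /relabel inr_gbeta_eq.
- by move=> w /=; rewrite reindexE.
- move=> w /=; rewrite reindexE /relabel inr_gbeta_eq /=.
  by case: eqP => [->|h]; [rewrite eqxx | case: eqP => // -[]].
Qed.

Lemma Phi_glue (e : gI G + gIO G) (f : gO G + gIO G) :
  Phi (glue e f) = ptr (galpha e) (gbeta f) (Phi G).
Proof.
case: e f => [e|e] [f|f].
- exact: Phi_glue_I_O.
- exact: Phi_glue_I_IO.
- exact: Phi_glue_IO_O.
- exact: Phi_glue_IO_IO.
Qed.

Lemma Phi_ptr i j : Phi (graph_ptr G i j) = ptr i j (Phi G).
Proof. by rewrite /graph_ptr Phi_glue !bij_preimK. Qed.

End Glue.
End Corollas.

(** * Linear extension from graphs to [Gr] *)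

Section LinearGr.
Local Open Scope ring_scope.
Variable K : fieldType.

Lemma linear_eq_gr (k l : nat) (M : lmodType K) (f g : Gr K k l -> M) :
  linear f -> linear g -> (forall G, f (gr_of K G) = g (gr_of K G)) -> f =1 g.
Proof.
move=> lf lg fg y.
have lin0 (h : Gr K k l -> M) : linear h -> h 0 = 0.
  move=> lh; have := lh (-1) 0 0; rewrite scaleN1r oppr0 addr0 => {1}->.
  by rewrite scaleN1r addNr.
rewrite [y]monalgE; elim/big_ind: _ => [|a b ha hb|c _].
- by rewrite !lin0.
- by have := lf 1 a b; have := lg 1 a b; rewrite !scale1r => -> ->; rewrite ha hb.
- have -> : << y@_c *g c >> = y@_c *: gr_of K (graph_of_class c) + 0 :> Gr K k l.
    by rewrite /gr_of graph_of_classK addr0; apply/malgP => d;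
      rewrite mcoeffZ !mcoeffU mulrnAr mulr1.
  by rewrite lf lg fg !lin0.
Qed.

Lemma linear_compose (U V W : lmodType K) (f : V -> W) (g : U -> V) :
  linear f -> linear g -> linear (fun z => f (g z)).
Proof. by move=> lf lg a u v; rewrite lg lf. Qed.

Lemma gr_hcat_linearr k l k' l' (p : Gr K k l) :
  linear (fun p' : Gr K k' l' => hcat p p').
Proof.
move=> a u v /=; rewrite /linext scaler_sumr -big_split /=.
apply: eq_bigr => c _; rewrite -!/(linext _ _) linext_linear scalerDr.
by rewrite !scalerA mulrC.
Qed.

End LinearGr.

Section Extension.
Variables (K : fieldType) (P : trap K) (x : forall k l : nat, P k l).
Hypothesis hx : forall (k l : nat) (s : 'S_l) (t : 'S_k),
  actr (actl s (x k l)) t = x k l.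
Let ax := trap_axioms P.

Definition gr_ext k l : Gr K k l -> P k l :=
  linext (fun c => Phi x (graph_of_class c)).

Lemma gr_ext_of k l (G : graph k l) : gr_ext (gr_of K G) = Phi x G.
Proof.
rewrite /gr_ext linext_basis; apply: Phi_iso => //; exact: graph_of_class_iso.
Qed.

Lemma gr_ext_linear k l : linear (@gr_ext k l).
Proof. exact: linext_linear. Qed.

(** Both sides of each compatibility are linear, in each argument for the concatenation, so they are
    compared on classes of graphs, where [Phi] has the property. *)
Lemma gr_ext_morphism : is_trap_morphism gr_ext.
Proof.
split.
- exact: gr_ext_linear.
- move=> k l s; apply: linear_eq_gr => [| |G].
  + by apply: linear_compose; [exact: gr_ext_linear | exact: linext_linear].
  + by apply: linear_compose; [exact: (actl_linear ax) | exact: gr_ext_linear].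
  + by rewrite gr_actl !gr_ext_of Phi_actl.
- move=> k l t; apply: (@linear_eq_gr K k l) => [| |G].
  + apply: linear_compose; [exact: gr_ext_linear | exact: linext_linear].
  + apply: (@linear_compose _ _ _ _ (fun p : P k l => actr p t));
    [exact: (actr_linear ax) | exact: gr_ext_linear].
  + by rewrite gr_actr !gr_ext_of Phi_actr.
- move=> k l k' l' p p'; move: p; apply: linear_eq_gr => [| |G].
  + apply: linear_compose; [exact: gr_ext_linear | exact: linext_linear].
  + apply: (@linear_compose _ _ _ _ (fun p : P k l => hcat p (gr_ext p')));
    [exact: (hcat_linearl ax) | exact: gr_ext_linear].
  + move: p'; apply: linear_eq_gr => [| |H].
    * by apply: linear_compose; [exact: gr_ext_linear | exact: gr_hcat_linearr].
    * by apply: linear_compose; [exact: (hcat_linearr ax) | exact: gr_ext_linear].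
    * by rewrite gr_hcat !gr_ext_of Phi_cat.
- move=> k l i j; apply: linear_eq_gr => [| |G].
  + by apply: linear_compose; [exact: gr_ext_linear | exact: linext_linear].
  + by apply: linear_compose; [exact: (ptr_linear ax) | exact: gr_ext_linear].
  + by rewrite gr_ptr !gr_ext_of Phi_ptr.
- by rewrite gr_ext_of Phi_empty.
- by rewrite gr_ext_of Phi_wire.
Qed.

Lemma gr_ext_corolla k l : gr_ext (gr_of K (corolla k l)) = x k l.
Proof. by rewrite gr_ext_of Phi_corolla. Qed.

End Extension.

(** * Uniqueness *)

(** Indices of external edges are forgotten, so that cutting and splitting need not keep track of
    any numbering. *)
Definition shape_iso k l k' l' (G : graph k l) (H : graph k' l') : Prop :=
  exists (fV : gV G -> gV H) (fE : gE G -> gE H) (fI : gI G -> gI H)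
    (fO : gO G -> gO H) (fIO : gIO G -> gIO H) (fL : gL G -> gL H),
  [/\ [/\ bijective fV, bijective fE & bijective fI],
      [/\ bijective fO, bijective fIO & bijective fL],
      forall y, gsrc (sum_map fE fO y) = fV (gsrc y)
    & forall y, gtgt (sum_map fE fI y) = fV (gtgt y)].

Lemma bij_perm (A B : finType) n (a : A -> 'I_n) (b : B -> 'I_n) (h : A -> B) :
  bijective a -> bijective b -> bijective h ->
  exists s : 'S_n, forall y, s (a y) = b (h y).
Proof.
move=> ab bb hb.
have si : injective (fun i => b (h (bij_preim ab i))).
  move=> i i' /(bij_inj bb) /(bij_inj hb) e.
  by rewrite -(bij_preimK ab i) e bij_preimK.
exists (perm si) => y; rewrite permE; congr (b (h _)).
by apply: (bij_inj ab); rewrite bij_preimK.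
Qed.

Lemma bij_ord_eq (A B : finType) n m (a : A -> 'I_n) (b : B -> 'I_m) (h : A -> B) :
  bijective a -> bijective b -> bijective h -> n = m.
Proof.
move=> /bij_eq_card e1 /bij_eq_card e2 /bij_eq_card e3.
by move: e1 e2; rewrite !card_ord e3 => <- <-.
Qed.

Section Uniqueness.
Variables (K : fieldType) (Q : trap_ops K) (f g : forall k l : nat, Gr K k l -> Q k l).
Hypotheses (hf : is_trap_morphism f) (hg : is_trap_morphism g).
Hypothesis fg : forall k l, f (gr_of K (corolla k l)) = g (gr_of K (corolla k l)).

Definition agree k l (G : graph k l) := f (gr_of K G) = g (gr_of K G).

(** The bijections force equal arities, and the two numberings differ by permutations, that is, by
    actions with which both morphisms commute. *)
Lemma agree_shape k l k' l' (G : graph k l) (H : graph k' l') :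
  shape_iso G H -> agree H -> agree G.
Proof.
case=> fV [fE [fI [fO [fIO [fL [[bV bE bI] [bO bIO bL] hs ht]]]]]].
have bi := sum_map_bij bI bIO; have bo := sum_map_bij bO bIO.
have ek := bij_ord_eq (galpha_bij G) (galpha_bij H) bi.
have el := bij_ord_eq (gbeta_bij G) (gbeta_bij H) bo.
subst k' l'.
have [t et] := bij_perm (galpha_bij G) (galpha_bij H) bi.
have [s es] := bij_perm (gbeta_bij G) (gbeta_bij H) bo.
have e : gr_of K G = actl (s^-1)%g (actr (gr_of K H : Gr K k l) t).
  rewrite gr_actr gr_actl; apply: gr_of_eq.
  exists fV, fE, fI, fO, fIO, fL; split=> // y /=.
    by rewrite -et permK.
  by rewrite -es permK.
rewrite /agree e (morph_actl hf) (morph_actr hf) (morph_actl hg) (morph_actr hg).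
by move=> ->.
Qed.

Lemma agree_cat k l k' l' (G : graph k l) (H : graph k' l') :
  agree G -> agree H -> agree (graph_cat G H).
Proof.
rewrite /agree => e1 e2.
by rewrite -gr_hcat (morph_hcat hf) (morph_hcat hg) e1 e2.
Qed.

Lemma agree_glue k l (G : graph k.+1 l.+1) (e : gI G + gIO G) (e' : gO G + gIO G) :
  agree G -> agree (glue e e').
Proof.
have -> : glue e e' = graph_ptr G (galpha e) (gbeta e').
  rewrite /graph_ptr; congr glue.
    by apply: (bij_inj (galpha_bij G)); rewrite bij_preimK.
  by apply: (bij_inj (gbeta_bij G)); rewrite bij_preimK.
rewrite /agree => h.
by rewrite -gr_ptr (morph_ptr hf) (morph_ptr hg) h.
Qed.

(** Only the shape matters, so the indices are arbitrary, here taken from enumerations. *)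
Definition shape_graph (V E I O IO L : finType) (s : E + O -> V) (t : E + I -> V) :
    graph #|{: I + IO}| #|{: O + IO}| :=
  @Graph _ _ V E I O IO L s t _ _ (@enum_rank_bij (I + IO)%type)
    (@enum_rank_bij (O + IO)%type).

Section CutEdge.
Variables (k l : nat) (G : graph k l).

Lemma opt_lift_bij (A : finType) n (a : A -> 'I_n) : bijective a ->
  bijective (fun o : option A => if o is Some y then lift ord0 (a y) else ord0).
Proof.
move=> ab; apply: fin_bij => [[y|] [y'|] //=|i].
- by move/lift_inj/(bij_inj ab) => ->.
- case: (unliftP ord0 i) => [j|] ->; last by exists None.
  by exists (Some (bij_preim ab j)); rewrite bij_preimK.
Qed.

Definition suml_opt (A B : Type) (z : option A + B) : option (A + B) :=
  match z with inl (Some y) => Some (inl y) | inl None => None | inr y => Some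
    (inr y) end.

Definition sumr_opt (A B : Type) (z : A + option B) : option (A + B) :=
  match z with inl y => Some (inl y) | inr None => None | inr (Some y) => Some
    (inr y) end.

Lemma suml_opt_bij (A B : Type) : bijective (@suml_opt A B).
Proof.
by exists (fun o => match o with Some (inl y) => inl (Some y) | None => inl None
  | Some (inr y) => inr y end) => [[[y|]|y]|[[y|y]|]].
Qed.

Lemma sumr_opt_bij (A B : Type) : bijective (@sumr_opt A B).
Proof.
by exists (fun o => match o with Some (inl y) => inl y | None => inr None
  | Some (inr y) => inr (Some y) end) => [[y|[y|]]|[[y|y]|]].
Qed.

(** The internal edge [e] is cut into a new first input and a new first output. *)
Definition cut_edge (e : gE G) : graph k.+1 l.+1 :=
  @Graph _ _ (gV G) {y : gE G | y != e} (option (gI G)) (option (gO G)) (gIO G) (gL G)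
    (fun z => match z with
              | inl y => gsrc (inl (val y))
              | inr (Some y) => gsrc (inr y)
              | inr None => gsrc (inl e)
              end)
    (fun z => match z with
              | inl y => gtgt (inl (val y))
              | inr (Some y) => gtgt (inr y)
              | inr None => gtgt (inl e)
              end)
    _ _ (bij_comp (opt_lift_bij (galpha_bij G)) (@suml_opt_bij _ _))
    (bij_comp (opt_lift_bij (gbeta_bij G)) (@suml_opt_bij _ _)).

(** The loop [z] is cut into a new input-output edge. *)
Definition cut_loop (z : gL G) : graph k.+1 l.+1 :=
  @Graph _ _ (gV G) (gE G) (gI G) (gO G) (option (gIO G)) {y : gL G | y != z}
    (@gsrc _ _ G) (@gtgt _ _ G)
    _ _ (bij_comp (opt_lift_bij (galpha_bij G)) (@sumr_opt_bij _ _))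
    (bij_comp (opt_lift_bij (gbeta_bij G)) (@sumr_opt_bij _ _)).

Lemma insub_bij (A : finType) (a : A) :
  bijective (fun y => insub y : option {y : A | y != a}).
Proof.
exists (fun o : option {y : A | y != a} => if o is Some y then val y else a) =>
  [y|[y|]] /=.
- by case: insubP => [u _ -> //|/negPn/eqP].
- by rewrite valK.
- by rewrite insubF ?eqxx.
Qed.

Lemma some_bij (A : finType) :
  bijective (fun y : A => Sub (Some y) isT : {o : option A | o != None}).
Proof.
apply: fin_bij => [y y' [] //|[[y|] //= h]].
by exists y; exact: val_inj.
Qed.

(** Regluing recreates the edge as [None], which is the value of [insub] at [e]. *)
Lemma cut_edge_iso (e : gE G) :
  shape_iso G (glue (G := cut_edge e) (inl None) (inl None)).
Proof.
exists id, (fun y => insub y), (fun y => Sub (Some y) isT), (fun y => Sub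
  (Some y) isT), id, id.
split.
- split; [by exists id | exact: insub_bij | exact: some_bij].
- split; [exact: some_bij | by exists id | by exists id].
- by case=> y //=; case: insubP => [u _ <- //|/negPn/eqP ->].
- by case=> y //=; case: insubP => [u _ <- //|/negPn/eqP ->].
Qed.

Lemma cut_loop_iso (z : gL G) :
  shape_iso G (glue (G := cut_loop z) (inr None) (inr None)).
Proof.
exists id, id, id, id, (fun y => Sub (Some y) isT), (fun y => insub y).
split=> //.
- by split; exists id.
- split; [by exists id | exact: some_bij | exact: insub_bij].
- by case.
- by case.
Qed.

End CutEdge.

Lemma empty_bij (A B : Type) (h : A -> B) : (A -> False) -> (B -> False) -> bijective h.
Proof.
by move=> nA nB; exists (fun y => match nB y return A with end) => y;
  [case: (nA y) | case: (nB y)].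
Qed.

Lemma shape_iso_sym k l k' l' (G : graph k l) (H : graph k' l') :
  shape_iso G H -> shape_iso H G.
Proof.
case=> fV [fE [fI [fO [fIO [fL [[bV bE bI] [bO bIO bL] hs ht]]]]]].
have [gV' VK KV] := bV; have [gE' EK KE] := bE; have [gI' IK KI] := bI.
have [gO' OK KO] := bO; have [gIO' IOK KIO] := bIO; have [gL' LK KL] := bL.
exists gV', gE', gI', gO', gIO', gL'; split; try by split; [exists fV | exists fE |
  exists fI] || (split; [exists fO | exists fIO | exists fL]).
- by move=> y; apply: (can_inj VK); rewrite KV -hs; case: y => y /=; rewrite ?KE ?KO.
- by move=> y; apply: (can_inj VK); rewrite KV -ht; case: y => y /=; rewrite ?KE ?KI.
Qed.

(** * Splitting off vertices and wires *)

Section RemoveVertex.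
Variables (k l : nat) (G : graph k l) (v : gV G).
Hypothesis noE : gE G -> False.
Hypothesis noL : gL G -> False.

Definition rem_src (z : void + {o : gO G | gsrc (inr o) != v}) : {u : gV G | u != v} :=
  match z with inl y => of_void _ y | inr y => Sub (gsrc (inr (val y))) (valP y) end.

Definition rem_tgt (z : void + {i : gI G | gtgt (inr i) != v}) : {u : gV G | u != v} :=
  match z with inl y => of_void _ y | inr y => Sub (gtgt (inr (val y))) (valP y) end.

Definition rem_vertex := shape_graph (gIO G) void rem_src rem_tgt.

Lemma enum_val_rem_bij (A : finType) (Q' : pred A) :
  bijective (sumf (fun n : 'I_#|Q'| => enum_val n) (fun y : {y | ~~ Q' y} => val y)).
Proof.
apply: fin_bij => [[n|y] [n'|y'] //=|y].
- by move/enum_val_inj => ->.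
- by case: y' => y' /= ny' e; exfalso; move: ny'; rewrite -e => /negP; apply;
  exact: enum_valP.
- by case: y => y /= ny e; exfalso; move: ny; rewrite e => /negP; apply;
  exact: enum_valP.
- by move/val_inj => ->.
- have [Qy|nQy] := boolP (Q' y); last by exists (inr (Sub y nQy)).
  have Qy' : y \in Q' by [].
  by exists (inl (enum_rank_in Qy' y)); rewrite /= enum_rankK_in.
Qed.

(** Without internal edges, whatever is attached to [v] is an input or an output; hence [v] and its
    half-edges form a corolla disjoint from the rest. *)
Lemma rem_vertex_iso : shape_iso G (graph_cat
  (corolla #|[pred i | gtgt (inr i) == v]| #|[pred o | gsrc (inr o) == v]|) rem_vertex).
Proof.
(* Maps out of the concatenation are given by cases on sums, which avoids deciding whether an
   element belongs to [v]. *)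
apply: shape_iso_sym.
exists (sumf (fun=> v) val), (sumf (of_void _) (of_void _)),
  (sumf (fun n => enum_val n) val), (sumf (fun n => enum_val n) val),
  (sumf (of_void _) id), (sumf (of_void _) (of_void _)).
split.
- split; [|by apply: empty_bij => // -[]|exact: enum_val_rem_bij].
  apply: fin_bij => [[[]|[u nu]] [[]|[u' nu']] //=|u].
  + by move=> e; exfalso; move: nu'; rewrite -e eqxx.
  + by move=> e; exfalso; move: nu; rewrite e eqxx.
  + by move=> e; congr inr; apply: val_inj.
  + by case: (eqVneq u v) => [->|ne]; [exists (inl tt) | exists (inr (Sub u ne))].
- split; [exact: enum_val_rem_bij| |by apply: empty_bij => // -[]].
  by exists inr => // -[[]|].
- case=> [[[]|[]]|[n|y]] //=.
  by move: (enum_valP n); rewrite inE => /eqP.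
- case=> [[[]|[]]|[n|y]] //=.
  by move: (enum_valP n); rewrite inE => /eqP.
Qed.

End RemoveVertex.

Definition void_src (z : void + void) : void := match z with inl y => y | inr y => y
  end.

Lemma rem_wire_iso k l (G : graph k l) (w : gIO G) : (gV G -> False) ->
  (gL G -> False) ->
  shape_iso G (graph_cat wire_graph
    (shape_graph {y : gIO G | y != w} void void_src void_src)).
Proof.
move=> noV noL; apply: shape_iso_sym.
have noE : gE G -> False by move=> e; exact: noV (gsrc (inl e)).
have noI : gI G -> False by move=> e; exact: noV (gtgt (inr e)).
have noO : gO G -> False by move=> e; exact: noV (gsrc (inr e)).
exists (sumf (of_void _) (of_void _)), (sumf (of_void _) (of_void _)),
  (sumf (of_void _) (of_void _)), (sumf (of_void _) (of_void _)),
  (sumf (fun=> w) val), (sumf (of_void _) (of_void _)).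
split.
- by split; apply: empty_bij => // -[].
- split; [by apply: empty_bij => // -[]| |by apply: empty_bij => // -[]].
  apply: fin_bij => [[[]|[u nu]] [[]|[u' nu']] //=|u].
  + by move=> e; exfalso; move: nu'; rewrite -e eqxx.
  + by move=> e; exfalso; move: nu; rewrite e eqxx.
  + by move=> e; congr inr; apply: val_inj.
  + by case: (eqVneq u w) => [->|ne]; [exists (inl tt) | exists (inr (Sub u ne))].
- by case=> -[].
- by case=> -[].
Qed.

Lemma empty_graph_iso k l (G : graph k l) : (gV G -> False) -> (gL G -> False) ->
  (gIO G -> False) -> shape_iso G empty_graph.
Proof.
move=> noV noL noIO; apply: shape_iso_sym.
have noE : gE G -> False by move=> e; exact: noV (gsrc (inl e)).
have noI : gI G -> False by move=> e; exact: noV (gtgt (inr e)).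
have noO : gO G -> False by move=> e; exact: noV (gsrc (inr e)).
exists (of_void _), (of_void _), (of_void _), (of_void _), (of_void _), (of_void _).
by split; [split; exact: empty_bij | split; exact: empty_bij | case=> -[] | case=> -[]].
Qed.

Definition ncard (A : finType) : nat := #|A|.

Lemma ncard_neq (A : finType) (a : A) : ncard {y : A | y != a} = (ncard A).-1.
Proof. by rewrite /ncard card_sub (cardC1 a). Qed.

Lemma ncard_option (A : finType) : ncard (option A) = (ncard A).+1.
Proof. exact: card_option. Qed.

Lemma ncard_void : ncard void = 0%N.
Proof. exact: card_void. Qed.

Lemma ncard_gt0 (A : finType) (a : A) : (0 < ncard A)%N.
Proof. by apply/card_gt0P; exists a. Qed.

(** Cutting a loop creates an input-output edge, so loops weigh two in the measure. Vertices are
    split off once edges and loops are gone, and wires once no vertex remains; the induction ends at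
    the empty graph. *)
Lemma agree_all k l (G : graph k l) : agree G.
Proof.
have [n] := ubnP (ncard (gE G) + (ncard (gL G)).*2 + ncard (gV G) + ncard (gIO G)).
elim: n k l G => // n IH k l G ltn.
have [e _|noE] := pickP (gE G).
  apply: agree_shape (cut_edge_iso e) _; apply: agree_glue; apply: IH => /=.
  rewrite ncard_neq; have := ncard_gt0 e.
  lia.
have [z _|noL] := pickP (gL G).
  apply: agree_shape (cut_loop_iso z) _; apply: agree_glue; apply: IH => /=.
  rewrite ncard_neq ncard_option; have := ncard_gt0 z.
  lia.
have no (A : finType) : pred_of_simpl
  (pred_of_argType A) =1 xpred0 -> A -> False by move=> h y; move: (h y).
have [v _|noV] := pickP (gV G).
  apply: agree_shape (rem_vertex_iso v (no _ noE) (no _ noL)) _; apply: agree_cat;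
    first exact: fg.
  apply: IH => /=; rewrite !ncard_neq ncard_void.
  have := ncard_gt0 v.
  lia.
have [w _|noIO] := pickP (gIO G).
  apply: agree_shape (rem_wire_iso w (no _ noV) (no _ noL)) _; apply: agree_cat.
    by rewrite /agree -[gr_of _ _]/(wire (Gr K)) (morph_wire hf) (morph_wire hg).
  apply: IH => /=; rewrite ncard_neq !ncard_void.
  have := ncard_gt0 w.
  lia.
apply: agree_shape (empty_graph_iso (no _ noV) (no _ noL) (no _ noIO)) _.
by rewrite /agree -[gr_of _ _]/(hunit (Gr K)) (morph_hunit hf) (morph_hunit hg).
Qed.

Lemma morphism_eq k l (y : Gr K k l) : f y = g y.
Proof.
have := linear_eq_gr (morph_linear hf (k := k) (l := l)) (morph_linear hg (k := k)
  (l := l)).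
by apply; exact: agree_all.
Qed.

End Uniqueness.

Theorem theorem5p18 (K : fieldType) (P : trap K)
  (x : forall k l : nat, P k l)
  (hx : forall (k l : nat) (s : 'S_l) (t : 'S_k),
     actr (actl s (x k l)) t = x k l) :
  exists f : forall k l : nat, Gr K k l -> P k l,
    (is_trap_morphism f /\
     forall k l : nat, f k l (gr_of K (corolla k l)) = x k l) /\
    (forall g : forall k l : nat, Gr K k l -> P k l,
       is_trap_morphism g /\
       (forall k l : nat, g k l (gr_of K (corolla k l)) = x k l) ->
       forall (k l : nat) (y : Gr K k l), g k l y = f k l y).
Proof.
exists (@gr_ext K P x); split; first split.
- exact: gr_ext_morphism.
- exact: gr_ext_corolla.
- move=> g [hg gx] k l y.
  apply: (morphism_eq hg (gr_ext_morphism hx)) => k' l'.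
  by rewrite gx gr_ext_corolla.
Qed.
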